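(* Let $D$ be a distributive algebraic lattice. If $D$ has at most $\aleph_1$ compact elements, then there exists a locally finite, relatively complemented lattice $L$ with zero such that $\operatorname{Con} L \cong D$.
   Context: For a lattice $L$, $\operatorname{Con} L$ denotes the lattice of all congruences of $L$ ordered by inclusion. An algebraic lattice is a complete lattice in which every element is a join of compact elements. A lattice is locally finite if each of its finitely generated sublattices is finite. A lattice $L$ is relatively complemented if for all $a\leq b\leq c$ in $L$ there is $x\in L$ with $b\wedge x=a$ and $b\vee x=c$. The zero of a lattice is its least element. *)

(* Defs.v *)
From HB Require Import structures.
From mathcomp Require Import all_boot all_order.
From mathcomp Require Import boolp classical_sets functions cardinality wochoice.

Set Implicit Arguments.
Unset Strict Implicit.
Unset Printing Implicit Defensive.

Local Open Scope classical_set_scope.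
Local Open Scope card_scope.
Local Open Scope order_scope.

Definition complete_lattice (d : Order.disp_t) (T : latticeType d) : Prop :=
  forall A : set T, supremums A !=set0 /\ infimums A !=set0.

(* [F] may be empty, in which case its supremum is the least element; thus the
   least element of a complete lattice is compact. *)
Definition compact_element (d : Order.disp_t) (T : latticeType d) (c : T) :
    Prop :=
  forall (A : set T) (s : T), supremums A s -> c <= s ->
    exists F : set T, [/\ finite_set F, F `<=` A &
      exists2 t : T, supremums F t & c <= t].

Definition algebraic_lattice (d : Order.disp_t) (T : latticeType d) : Prop :=
  complete_lattice T /\
  forall x : T, exists A : set T,
    A `<=` [set c | compact_element c] /\ supremums A x.

(* [R] is the reflexive order of a well-ordering of type omega_1, the first
   uncountable ordinal. *)
Definition omega1_order (W : Type) (R : rel W) : Prop :=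
  [/\ well_order R, ~ countable [set: W] &
      forall x : W, countable [set y : W | R y x /\ y <> x]].

(* aleph_1 is the cardinality of any well-ordered set of type omega_1. *)
Definition card_le_aleph1 (T : Type) (A : set T) : Prop :=
  exists (W : Type) (R : rel W), omega1_order R /\ A #<= [set: W].

Section Lattices.
Variables (d : Order.disp_t) (L : latticeType d).

(* The empty set counts as a sublattice; this does not affect which lattices are
   locally finite. *)
Definition sublattice (S : set L) : Prop :=
  forall x y : L, S x -> S y -> S (Order.meet x y) /\ S (Order.join x y).

Definition locally_finite : Prop :=
  forall X : set L, finite_set X -> finite_set (smallest sublattice X).

Definition relatively_complemented : Prop :=
  forall a b c : L, a <= b -> b <= c ->
    exists x : L, Order.meet b x = a /\ Order.join b x = c.

Record congruence : Type := Congruence {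
  con_rel :> L -> L -> Prop;
  con_equivalence : RelationClasses.Equivalence con_rel;
  con_meet : forall x x' y y' : L, con_rel x x' -> con_rel y y' ->
    con_rel (Order.meet x y) (Order.meet x' y');
  con_join : forall x x' y y' : L, con_rel x x' -> con_rel y y' ->
    con_rel (Order.join x y) (Order.join x' y') }.

HB.instance Definition _ := gen_eqMixin congruence.
HB.instance Definition _ := gen_choiceMixin congruence.

Definition con_le (t u : congruence) : bool :=
  `[< forall x y : L, t x y -> u x y >].

Lemma con_leP (t u : congruence) :
  reflect (forall x y : L, t x y -> u x y) (con_le t u).
Proof. exact: asboolP. Qed.

Lemma congruence_inj (t u : congruence) :
  con_rel t = con_rel u -> t = u.
Proof.
case: t u => [r e m j] [r' e' m' j'] /= E.
move: e' m' j'; rewrite -{}E => e' m' j'.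
by rewrite (Prop_irrelevance e' e) (Prop_irrelevance m' m) (Prop_irrelevance j' j).
Qed.

Lemma con_le_refl : reflexive con_le.
Proof. by move=> t; apply/con_leP. Qed.

Lemma con_le_anti : antisymmetric con_le.
Proof.
move=> t u /andP[/con_leP tu /con_leP ut]; apply: congruence_inj.
by apply/funext => x; apply/funext => y; apply/propext; split=> [/tu|/ut].
Qed.

Lemma con_le_trans : transitive con_le.
Proof.
move=> t u v /con_leP ut /con_leP tv; apply/con_leP => x y /ut; exact: tv.
Qed.

Lemma con_inf_subproof (P : set congruence) :
  RelationClasses.Equivalence (fun x y => forall t, P t -> con_rel t x y).
Proof.
split=> [x t _|x y xy t Pt|x y z xy yz t Pt].
- by have [rt _ _] := con_equivalence t; apply: rt.
- by have [_ st _] := con_equivalence t; apply/st/xy.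
- have [_ _ tt] := con_equivalence t.
  by apply: (tt _ y); [apply: xy|apply: yz].
Qed.

Definition con_inf (P : set congruence) : congruence.
Proof.
refine (@Congruence (fun x y => forall t, P t -> con_rel t x y)
  (con_inf_subproof P) _ _).
- by move=> x x' y y' xx yy t Pt; apply: con_meet; [apply: xx|apply: yy].
- by move=> x x' y y' xx yy t Pt; apply: con_join; [apply: xx|apply: yy].
Defined.

Definition con_meet2 (t u : congruence) : congruence :=
  con_inf [set v | v = t \/ v = u].

Definition con_join2 (t u : congruence) : congruence :=
  con_inf [set v | con_le t v /\ con_le u v].

Lemma con_meet2P (t u v : congruence) :
  con_le t (con_meet2 u v) = con_le t u && con_le t v.
Proof.
apply/con_leP/andP => [h|[/con_leP hu /con_leP hv] x y txy w [->|->]].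
- by split; apply/con_leP => x y /h; apply; [left|right].
- exact: hu.
- exact: hv.
Qed.

Lemma con_join2P (t u v : congruence) :
  con_le (con_join2 t u) v = con_le t v && con_le u v.
Proof.
apply/con_leP/andP => [h|[tv uv] x y]; last by apply.
by split; apply/con_leP => x y xy; apply: h => w [/con_leP tw /con_leP uw];
  [apply: tw|apply: uw].
Qed.

End Lattices.

Fact con_display : Order.disp_t. Proof. exact: Order.Disp tt tt. Qed.

(* [Con L], ordered by inclusion. *)
HB.instance Definition _ (d : Order.disp_t) (L : latticeType d) :=
  Order.Le_isPOrder.Build con_display (congruence L)
    (@con_le_refl d L) (@con_le_anti d L) (@con_le_trans d L).
HB.instance Definition _ (d : Order.disp_t) (L : latticeType d) :=
  Order.POrder_MeetJoin_isLattice.Build con_display (congruence L)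
    (@con_meet2P d L) (@con_join2P d L).

Definition lattice_isomorphic (d d' : Order.disp_t) (L : latticeType d)
    (M : latticeType d') : Prop :=
  exists f : L -> M,
    [/\ bijective f, Order.meet_morphism f & Order.join_morphism f].

(* Main.v *)
Require Import Defs.
From HB Require Import structures.
From mathcomp Require Import all_boot all_order.
From mathcomp Require Import boolp classical_sets functions cardinality wochoice.
Import Order.TTheory.
Local Open Scope classical_set_scope.
Set Implicit Arguments.
Unset Strict Implicit.
Unset Printing Implicit Defensive.

(** The lattice L is built together with a distance [dist : L -> L -> D] whose
    values are compact and for which every relation [dist x y <= c] is a
    congruence. Writing mu x for [dist 0 x], the map sending c to the congruence
    [dist x y <= c] is an isomorphism from D onto Con L as soon as
    - L is relatively complemented, so that a congruence is determined by its
      zero class;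
    - every compact element of D is a value of mu;
    - mu x <= mu y implies that each congruence with y in its zero class also
      has x there.
    The third condition is secured by a witness: elements q, q' with
    q /\ q' = 0 and x <= (q \/ y) /\ (q' \/ y). Indeed, if y is congruent to
    0, then so is (q \/ y) /\ (q' \/ y), being congruent to q /\ q'. The
    isomorphism is [con_lattice_isomorphic]. All three conditions thus ask for
    the existence of elements, and an element that serves its purpose continues
    to do so in every extension of L that preserves the distance. It remains to
    construct such extensions ([solves]).

    On a finite piece of L the distance is required to be Boolean: there are
    finitely many congruences theta_i with compact weights s_i, and [dist x y]
    is the join of the s_i such that theta_i does not relate x and y
    ([represents]). Distributivity of D enters through [refine_pair] only: if one
    such join lies below another one, then the family of weighted congruences
    can be refined, without changing the distance, so that the inequality
    holds already for the index sets. After refinement two finite pieces G and H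
    that share a finite lattice F carry congruences indexed by the same set,
    with equal restrictions to F, and whenever mu x <= mu y every theta_i with
    y in its zero class has x there too. For each index one amalgamates
    G / theta_i and H / theta_i over F in a finite lattice of closed sets that
    contains relative complements for G and H and two disjoint elements q, q'
    whose join with any nonzero element of G or H is the top. The product over
    all indices is the amalgam of G and H over F ([amalgamation]).

    Amalgams of two lattices suffice for aleph_1 compact elements. A countable
    L is the union of a chain of finite pieces X_n, and a chain of amalgams
    G_(n+1) of G_n and X_(n+1) over X_n has as its union a countable extension
    of L with all the missing elements ([countable_step]). Iterating this along
    omega_1, with unions at limit stages, keeps every stage countable and uses
    up all compact elements of D ([solved_lattice_exists]). Local finiteness
    holds because every finite set lies in a finite piece. *)

(** * Compact elements and weighted families of sets *)
Section Compact.
Local Open Scope order_scope.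
Variables (d : Order.disp_t) (D : distrLatticeType d).
Hypothesis hD : algebraic_lattice D.
Implicit Types (a b c x y : D) (A B : set D).

(** A chosen supremum: D is complete, but its order structure provides binary
    joins only. *)
Definition dsup A : D := projT1 (cid (proj1 (proj1 hD A))).

Lemma dsup_supremum A : supremums A (dsup A).
Proof. by rewrite /dsup; case: cid. Qed.

Lemma dsup_ub A a : A a -> a <= dsup A.
Proof. by case: (dsup_supremum A) => + _; apply. Qed.

Lemma dsup_le A x : (forall a, A a -> a <= x) -> dsup A <= x.
Proof. by case: (dsup_supremum A) => _; apply. Qed.

Lemma dsupS A B : A `<=` B -> dsup A <= dsup B.
Proof. by move=> AB; apply: dsup_le => a /AB; apply: dsup_ub. Qed.

Lemma compact_dsup c A : compact_element c -> c <= dsup A ->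
  exists F, [/\ finite_set F, F `<=` A & c <= dsup F].
Proof.
move=> cc cA; have [F [fF FA [t [_ tF] ct]]] := cc _ _ (dsup_supremum A) cA.
by exists F; split=> //; apply: le_trans ct _; apply: tF => a; apply: dsup_ub.
Qed.

Lemma compact_join a b :
  compact_element a -> compact_element b -> compact_element (a `|` b).
Proof.
move=> ca cb A s sA; rewrite leUx => /andP[la lb].
have [F [fF FA [t tF at_]]] := ca _ _ sA la.
have [G [fG GA [u uG bu]]] := cb _ _ sA lb.
exists (F `|` G)%classic; split; [by rewrite finite_setU|by move=> x [/FA|/GA]|].
exists (dsup (F `|` G)%classic); first exact: dsup_supremum.
rewrite leUx; apply/andP; split.
  by apply: le_trans at_ _; apply: tF.2 => x Fx; apply: dsup_ub; left.
by apply: le_trans bu _; apply: uG.2 => x Gx; apply: dsup_ub; right.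
Qed.

Lemma dsup_cons a (s : seq D) : dsup [set` a :: s] = a `|` dsup [set` s].
Proof.
apply/le_anti/andP; split.
  apply: dsup_le => x /=; rewrite inE => /orP[/eqP->|xs]; first exact: leUl.
  by apply: lexUr; apply: dsup_ub.
rewrite leUx dsup_ub /= ?mem_head //=; apply: dsupS => x /= xs.
by rewrite inE xs orbT.
Qed.

Lemma dsup_nil x : dsup [set` [::]] <= x.
Proof. by apply: dsup_le. Qed.

Lemma compact_finite A : finite_set A ->
  (forall a, A a -> compact_element a) -> compact_element (dsup A).
Proof.
move=> /finite_seqP[s ->]; elim: s => [_ B y _ _|a s IH cs].
  exists set0; split=> //; exists (dsup set0); first exact: dsup_supremum.
  by apply: dsup_le.
rewrite dsup_cons; apply: compact_join; first by apply: cs; rewrite /= mem_head.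
by apply: IH => b bs; apply: cs; rewrite /= inE bs orbT.
Qed.

Lemma meet_dsup_le c x A : finite_set A ->
  (forall a, A a -> c `&` a <= x) -> c `&` dsup A <= x.
Proof.
move=> /finite_seqP[s ->]; elim: s => [_|a s IH cs].
  by apply: leIxr; apply: dsup_nil.
rewrite dsup_cons meetUr leUx cs /= ?mem_head //; apply: IH => b bs.
by apply: cs; rewrite /= inE bs orbT.
Qed.

(** Refinement property of the compact elements. By distributivity c is the
    join of the meets of c with the members of A. Such a meet need not be
    compact, but it is a join of compact elements, finitely many of which
    suffice to reach c. *)
Lemma compact_refine c A : compact_element c -> finite_set A -> c <= dsup A ->
  exists t : D -> D, [/\ forall a, compact_element (t a),
    forall a, t a <= a, forall a, t a <= c & c <= dsup (t @` A)].
Proof.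
move=> cc fA cA.
pose K := [set k | compact_element k /\ exists2 a, A a & k <= c `&` a].
have cK : c <= dsup K.
  rewrite -[leLHS](meet_idPl cA); apply: meet_dsup_le => // a Aa.
  have [C [CK sC]] := hD.2 (c `&` a).
  by apply: sC.2 => k Ck; apply: dsup_ub; split; [apply: CK|exists a => //; apply: sC.1].
have [F [fF FK cF]] := compact_dsup cc cK.
exists (fun a => dsup [set k | F k /\ k <= a]); split=> [a|a|a|].
- apply: compact_finite => [|k [/FK[]]] //.
  by apply: sub_finite_set fF => k [].
- by apply: dsup_le => k [].
- by apply: dsup_le => k [/FK[_ [b _]]]; rewrite lexI => /andP[].
apply: le_trans cF _; apply: dsup_le => k Fk.
have [_ [a Aa]] := FK _ Fk; rewrite lexI => /andP[_ ka].
apply: (@le_trans _ _ (dsup [set k | F k /\ k <= a])); first exact: dsup_ub.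
by apply: dsup_ub; exists a.
Qed.

(** A set of pairs (A, s) gives each q the value formed by joining the weights s
    of the sets A that contain q. Such values are used through their upper
    bounds only. *)
Definition value_le (Q : Type) (S : set (set Q * D)) (q : Q) (x : D) : Prop :=
  forall i, S i -> i.1 q -> i.2 <= x.

Definition system (Q : Type) (S : set (set Q * D)) : Prop :=
  finite_set S /\ forall i, S i -> compact_element i.2.

(** The value of q is below that of q', and the new family makes this visible on
    the sets themselves. A pair (A, s) with q in A and q' not in A is bad. Its
    weight lies below the join of the weights s_j of the pairs (A_j, s_j) with
    q' in A_j, so s is the join of compact t_j <= s_j. Replacing (A, s) by all
    (A \/ A_j, t_j) changes no value: on A the t_j join to s, and on A_j the
    weight t_j is absorbed by s_j. *)
Lemma refine_pair (Q : Type) (S : set (set Q * D)) (q q' : Q) :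
  system S -> (forall x, value_le S q' x -> value_le S q x) ->
  exists S', [/\ system S', forall p x, value_le S' p x <-> value_le S p x,
    forall i, S' i -> i.1 q -> i.1 q' &
    forall i, S' i -> exists j k, [/\ S j, S k & i.1 = j.1 `|` k.1]%classic].
Proof.
move=> [fS cS] qq.
pose B := [set j | S j /\ j.1 q'].
have fB : finite_set B by apply: sub_finite_set fS => j [].
pose bad i := [/\ S i, i.1 q & ~ i.1 q'].
have /choice[T HT] : forall i, exists t : D -> D, bad i ->
    [/\ forall a, compact_element (t a),
    forall a, t a <= a, forall a, t a <= i.2 & i.2 <= dsup (t @` (snd @` B))].
  move=> i; have [bi|nb] := pselect (bad i); last by exists id => /nb.
  have [Si iq _] := bi.
  have [|t [*]] := @compact_refine i.2 (snd @` B) (cS _ Si) (finite_image _ fB).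
    apply: (qq (dsup (snd @` B))) => // j Sj jq.
    by apply: dsup_ub; exists j.
  by exists t.
exists ([set i | S i /\ ~ bad i] `|`
  (fun ij => (ij.1.1 `|` ij.2.1, T ij.1 ij.2.2)) @` (bad `*` B))%classic.
split.
- split.
    rewrite finite_setU; split; first by apply: sub_finite_set fS => j [].
    apply/finite_image/finite_setX => //.
    by apply: sub_finite_set fS => j [].
  move=> i [[Si _]|[[j k] [/= bj _] <-]] /=; first exact: cS.
  by have [] := HT _ bj.
- move=> p x; split=> H i.
    move=> Si ip; have [bi|nb] := pselect (bad i); last by apply: H => //; left.
    have [_ _ _ l] := HT _ bi; apply: le_trans l _.
    apply: dsup_le => _ [_ [j Bj <-] <-].
    by apply: (H (i.1 `|` j.1, T i j.2)%classic) => /=; [right; exists (i, j)|left].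
  move=> [[Si _] ip|[[j k] [/= bj [Sk kq]] <-]] /=; first exact: H.
  have [_ t1 t2 _] := HT _ bj.
  case=> h; first by apply: le_trans (t2 _) _; apply: H => //; case: bj.
  by apply: le_trans (t1 _) _; apply: H.
- move=> i [[Si nb]|[[j k] [/= _ [_ kq]] <-]] /=; last by right.
  by move=> iq; apply: contrapT => niq; apply: nb.
- move=> i [[Si _]|[[j k] [/= [bj _ _] [Sk _]] <-]] /=.
    by exists i, i; rewrite setUid.
  by exists j, k.
Qed.

(** The requirements of R can be met one after the other, since an implication
    between memberships is inherited by unions of sets, as is C. *)
Lemma refine_system (Q : Type) (S : set (set Q * D)) (R : set (Q * Q))
    (C : set (set Q)) :
  system S -> finite_set R ->
  (forall p x, R p -> value_le S p.2 x -> value_le S p.1 x) ->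
  (forall (X Y : set Q), C X -> C Y -> C (X `|` Y)%classic) ->
  (forall i, S i -> C i.1) ->
  exists S', [/\ system S', forall p x, value_le S' p x <-> value_le S p x,
    forall i p, S' i -> R p -> i.1 p.1 -> i.1 p.2 & forall i, S' i -> C i.1].
Proof.
move=> sS /(@finite_seqP {classic (Q * Q)})[s ->].
elim: s => [_ _ CS|[q q'] s IH Rs CU CS].
  by exists S; split.
have [|//|//|S1 [sS1 e1 r1 C1]] := IH.
  by move=> p x ps; apply: Rs; rewrite /= inE ps orbT.
have [|S2 [sS2 e2 r2 u2]] := @refine_pair Q S1 q q' sS1.
  move=> x /e1 H; apply/e1; apply: (Rs (q, q') x) => //=.
  by rewrite mem_head.
exists S2; split=> //.
- by move=> p x; rewrite e2.
- move=> i p Si /=; rewrite inE => /orP[/eqP->/=|ps]; first exact: r2.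
  have [j [k [Sj Sk ->]]] := u2 _ Si.
  by move=> [h|h]; [left; apply: (r1 j)|right; apply: (r1 k)].
by move=> i /u2[j [k [Sj Sk ->]]]; apply: CU; apply: C1.
Qed.

End Compact.

(** * Lattices with a distance *)
Section Structures.
Variables (d : Order.disp_t) (D : distrLatticeType d).

(** Operations are total on an ambient type and only meaningful on the carrier.
    Extensions then are inclusions of carriers in one fixed type, and chains of
    extensions have genuine unions. *)
Record valued (V : Type) : Type := Valued {
  car : set V;
  mt : V -> V -> V;
  jn : V -> V -> V;
  dist : V -> V -> D;
  bot : V }.

(** The last field says that distance zero, the least value, means equality. In
    particular, maps that preserve the distance are injective. *)
Record lattice_on (V : Type) (M : valued V) (X : set V) : Prop := LatticeOn {
  lbot : X (bot M);
  lmt : forall x y, X x -> X y -> X (mt M x y);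
  ljn : forall x y, X x -> X y -> X (jn M x y);
  mtC : forall x y, X x -> X y -> mt M x y = mt M y x;
  jnC : forall x y, X x -> X y -> jn M x y = jn M y x;
  mtA : forall x y z, X x -> X y -> X z ->
    mt M x (mt M y z) = mt M (mt M x y) z;
  jnA : forall x y z, X x -> X y -> X z ->
    jn M x (jn M y z) = jn M (jn M x y) z;
  jnmt : forall x y, X x -> X y -> jn M x (mt M x y) = x;
  mtjn : forall x y, X x -> X y -> mt M x (jn M x y) = x;
  mt0 : forall x, X x -> mt M (bot M) x = bot M;
  dist_eq0 : forall x y, X x -> X y -> (forall c, (dist M x y <= c)%O) <-> x = y }.

Record cong_on (V : Type) (M : valued V) (X : set V) (R : V -> V -> Prop) :
    Prop := CongOn {
  cong_refl : forall x, X x -> R x x;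
  cong_sym : forall x y, X x -> X y -> R x y -> R y x;
  cong_trans : forall x y z, X x -> X y -> X z -> R x y -> R y z -> R x z;
  cong_mt : forall x y z, X x -> X y -> X z -> R x y ->
    R (mt M x z) (mt M y z);
  cong_jn : forall x y z, X x -> X y -> X z -> R x y ->
    R (jn M x z) (jn M y z) }.

(** The sets of S are complements of congruences: a weight counts for the pairs
    that its congruence does not identify. *)
Definition represents (V : Type) (M : valued V) (X : set V)
    (S : set (set (V * V) * D)) : Prop :=
  [/\ system S, forall i, S i -> cong_on M X (fun x y => ~ i.1 (x, y)) &
    forall x y c, X x -> X y -> ((dist M x y <= c)%O <-> value_le S (x, y) c)].

Definition representable (V : Type) (M : valued V) (X : set V) : Prop :=
  [/\ finite_set X, lattice_on M X & exists S, represents M X S].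

(** Every law used below involves finitely many elements, so a lattice with this
    property inherits the laws, the congruences [dist x y <= c] and the
    compactness of the distances from its finite pieces. *)
Definition locally_representable (V : Type) (M : valued V) : Prop :=
  forall A, finite_set A -> A `<=` car M ->
    exists X, [/\ A `<=` X, X `<=` car M & representable M X].

Record hom (V V' : Type) (M : valued V) (X : set V) (N : valued V') (f : V -> V') :
    Prop := Hom {
  hom_car : forall x, X x -> car N (f x);
  hom_mt : forall x y, X x -> X y -> f (mt M x y) = mt N (f x) (f y);
  hom_jn : forall x y, X x -> X y -> f (jn M x y) = jn N (f x) (f y);
  hom_dist : forall x y, X x -> X y -> dist M x y = dist N (f x) (f y);
  hom_bot : f (bot M) = bot N }.

Definition ext (V : Type) (M N : valued V) : Prop := hom M (car M) N id.

Lemma hom_comp (V V' V'' : Type) (M : valued V) X (N : valued V') (P : valued V'')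
    (f : V -> V') (g : V' -> V'') :
  hom M X N f -> hom N (car N) P g -> hom M X P (g \o f).
Proof.
move=> [f1 f2 f3 f4 f5] [g1 g2 g3 g4 g5]; split=> /=.
- by move=> x /f1/g1.
- by move=> x y hx hy; rewrite f2 // g2 //; apply: f1.
- by move=> x y hx hy; rewrite f3 // g3 //; apply: f1.
- by move=> x y hx hy; rewrite f4 // g4 //; apply: f1.
- by rewrite f5.
Qed.

Lemma hom_sub (V V' : Type) (M : valued V) X Y (N : valued V') (f : V -> V') :
  Y `<=` X -> hom M X N f -> hom M Y N f.
Proof. by move=> s [f1 f2 f3 f4 f5]; split; eauto. Qed.

Lemma hom_eq (V V' : Type) (M : valued V) X (N : valued V') (f g : V -> V') :
  lattice_on M X -> (forall x, X x -> f x = g x) -> hom M X N f -> hom M X N g.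
Proof.
move=> L e [f1 f2 f3 f4 f5]; split.
- by move=> x hx; rewrite -e //; apply: f1.
- by move=> x y hx hy; rewrite -!e ?f2 //; apply: lmt.
- by move=> x y hx hy; rewrite -!e ?f3 //; apply: ljn.
- by move=> x y hx hy; rewrite -!e ?f4.
- by rewrite -e ?f5 //; apply: lbot.
Qed.

Lemma hom_id (V : Type) (M : valued V) X : X `<=` car M -> hom M X M id.
Proof. by move=> s; split. Qed.

Lemma ext_trans (V : Type) (M N P : valued V) : ext M N -> ext N P -> ext M P.
Proof. exact: hom_comp. Qed.

Lemma hom_inj (V V' : Type) (M : valued V) X (N : valued V') (f : V -> V') :
  lattice_on M X -> hom M X N f -> forall x y, X x -> X y -> f x = f y -> x = y.
Proof.
move=> L h x y hx hy e; apply/(dist_eq0 L) => // c.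
rewrite (hom_dist h) // -e -(hom_dist h) //; exact: (dist_eq0 L hx hx).2.
Qed.

Lemma cong_image (V V' : Type) (M : valued V) X (N : valued V') (f : V -> V') R R' :
  lattice_on M X -> hom M X N f -> cong_on M X R ->
  (forall x y, X x -> X y -> R' (f x) (f y) <-> R x y) ->
  cong_on N (f @` X) R'.
Proof.
move=> L h C E; split.
- by move=> _ [x hx <-]; apply/E => //; apply: cong_refl C _ _.
- by move=> _ _ [x hx <-] [y hy <-] /E H; apply/E => //; apply: cong_sym C _ _ _ _ _; auto.
- move=> _ _ _ [x hx <-] [y hy <-] [z hz <-] /E H /E H'; apply/E => //.
  by apply: (cong_trans C (y := y)) => //; auto.
- move=> _ _ _ [x hx <-] [y hy <-] [z hz <-] /E H.
  rewrite -!(hom_mt h) //; apply/E; try exact: lmt.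
  by apply: (cong_mt C) => //; auto.
- move=> _ _ _ [x hx <-] [y hy <-] [z hz <-] /E H.
  rewrite -!(hom_jn h) //; apply/E; try exact: ljn.
  by apply: (cong_jn C) => //; auto.
Qed.

Lemma lattice_on_image (V V' : Type) (M : valued V) X (N : valued V') (f : V -> V') :
  lattice_on M X -> hom M X N f -> lattice_on N (f @` X).
Proof.
move=> L h; split.
- by exists (bot M); [apply: lbot|apply: hom_bot h].
- move=> _ _ [x hx <-] [y hy <-]; exists (mt M x y); [exact: lmt|exact: hom_mt h _ _ _ _].
- move=> _ _ [x hx <-] [y hy <-]; exists (jn M x y); [exact: ljn|exact: hom_jn h _ _ _ _].
- by move=> _ _ [x hx <-] [y hy <-]; rewrite -!(hom_mt h) // (mtC L).
- by move=> _ _ [x hx <-] [y hy <-]; rewrite -!(hom_jn h) // (jnC L).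
- move=> _ _ _ [x hx <-] [y hy <-] [z hz <-].
  by rewrite -!(hom_mt h) ?(mtA L) //; apply: lmt.
- move=> _ _ _ [x hx <-] [y hy <-] [z hz <-].
  by rewrite -!(hom_jn h) ?(jnA L) //; apply: ljn.
- move=> _ _ [x hx <-] [y hy <-]; rewrite -(hom_mt h) // -(hom_jn h) ?(jnmt L) //.
  exact: lmt.
- move=> _ _ [x hx <-] [y hy <-]; rewrite -(hom_jn h) // -(hom_mt h) ?(mtjn L) //.
  exact: ljn.
- by move=> _ [x hx <-]; rewrite -(hom_bot h) -(hom_mt h) ?(mt0 L) //; apply: lbot.
- move=> _ _ [x hx <-] [y hy <-]; rewrite -(hom_dist h) // (dist_eq0 L) //.
  by split=> [->//|]; apply: hom_inj L h _ _ _ _.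
Qed.

Lemma representable_image (V V' : Type) (M : valued V) X (N : valued V') (f : V -> V') :
  representable M X -> hom M X N f -> representable N (f @` X).
Proof.
move=> [fX L [S [[fS cS] CS kS]]] h; split; first exact: finite_image.
  exact: lattice_on_image L h.
pose im (A : set (V * V)) : set (V' * V') :=
  [set p | exists x y, [/\ X x, X y, A (x, y) & p = (f x, f y)]].
have imE A x y : X x -> X y -> im A (f x, f y) <-> A (x, y).
  move=> hx hy; split; last by move=> Axy; exists x, y.
  move=> [x' [y' [hx' hy' A' [ex ey]]]].
  by rewrite (hom_inj L h hx hx' ex) (hom_inj L h hy hy' ey).
exists ((fun i => (im i.1, i.2)) @` S); split.
- split; first exact: finite_image.
  by move=> _ [i Si <-] /=; apply: cS.
- move=> _ [i Si <-] /=; apply: (cong_image L h (CS _ Si)) => x y hx hy.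
  by rewrite imE.
move=> _ _ c [x hx <-] [y hy <-]; rewrite -(hom_dist h) // kS //; split=> H.
  by move=> _ [i Si <-] /= /imE I; apply: H => //; apply: I.
by move=> i Si ixy; apply: (H (im i.1, i.2)) => /=; [exists i|apply/imE].
Qed.

Lemma locally_representable_image (V V' : Type) (M : valued V) (N : valued V') (f : V -> V') :
  locally_representable M -> hom M (car M) N f -> car N = f @` car M -> locally_representable N.
Proof.
move=> gM h e A fA AN.
have /choice[g Hg] : forall y, exists x, A y -> car M x /\ f x = y.
  move=> y; have [/AN|] := pselect (A y); last by exists (bot M).
  by rewrite e => -[x hx <-]; exists x.
have [|X [gX XM rX]] := gM (g @` A) (finite_image _ fA).
  by move=> _ [y Ay <-]; case: (Hg y).
exists (f @` X); split.
- by move=> y Ay; exists (g y); [apply: gX; exists y|case: (Hg y)].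
- by move=> _ [x hx <-]; rewrite e; exists x => //; apply: XM.
by apply: representable_image rX _; apply: hom_sub h.
Qed.

Lemma locally_representable_lattice (V : Type) (M : valued V) :
  locally_representable M -> lattice_on M (car M).
Proof.
move=> gM.
have G x y z : car M x -> car M y -> car M z ->
    exists X, [/\ X x, X y, X z, X `<=` car M & lattice_on M X].
  move=> hx hy hz.
  have [|X [s XM [_ L _]]] := gM [set x; y; z] (finite_set3 _ _ _).
    by move=> u [[->|->]|->].
  by exists X; split=> //; apply: s; [left; left|left; right|right].
split.
- by have [//|X [_ XM [_ L _]]] := gM set0 (finite_set0 _); apply/XM/(lbot L).
- by move=> x y hx hy; have [X [? ? _ XM L]] := G _ _ _ hx hy hy; apply/XM/(lmt L).
- by move=> x y hx hy; have [X [? ? _ XM L]] := G _ _ _ hx hy hy; apply/XM/(ljn L).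
- by move=> x y hx hy; have [X [? ? _ XM L]] := G _ _ _ hx hy hy; apply: (mtC L).
- by move=> x y hx hy; have [X [? ? _ XM L]] := G _ _ _ hx hy hy; apply: (jnC L).
- by move=> x y z hx hy hz; have [X [? ? ? XM L]] := G _ _ _ hx hy hz; apply: (mtA L).
- by move=> x y z hx hy hz; have [X [? ? ? XM L]] := G _ _ _ hx hy hz; apply: (jnA L).
- by move=> x y hx hy; have [X [? ? _ XM L]] := G _ _ _ hx hy hy; apply: (jnmt L).
- by move=> x y hx hy; have [X [? ? _ XM L]] := G _ _ _ hx hy hy; apply: (mtjn L).
- by move=> x hx; have [X [? ? _ XM L]] := G _ _ _ hx hx hx; apply: (mt0 L).
- by move=> x y hx hy; have [X [? ? _ XM L]] := G _ _ _ hx hy hy; apply: (dist_eq0 L).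
Qed.

(** The relation [dist x y <= c] is the intersection of the congruences whose
    weight is not below c. *)
Lemma represents_cong (V : Type) (M : valued V) X S (c : D) : lattice_on M X ->
  represents M X S -> cong_on M X (fun x y => (dist M x y <= c)%O).
Proof.
move=> L [sS CS kS].
have E x y : X x -> X y -> (dist M x y <= c)%O <->
    forall i, S i -> ~ (i.2 <= c)%O -> ~ i.1 (x, y).
  move=> hx hy; rewrite kS //; split=> H i Si; first by move=> + /(H _ Si).
  by move=> h; apply: contrapT => /(H _ Si); apply.
split.
- by move=> x hx; apply/E => // i Si _; apply: (cong_refl (CS i Si)).
- move=> x y hx hy /E H; apply/E => // i Si ic.
  by apply: (cong_sym (CS i Si)) => //; apply: H.
- move=> x y z hx hy hz /E H /E H'; apply/E => // i Si ic.
  by apply: (cong_trans (CS i Si) (y := y)) => //; [apply: H|apply: H'].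
- move=> x y z hx hy hz /E H; apply/E; try exact: lmt.
  by move=> i Si ic; apply: (cong_mt (CS i Si)) => //; apply: H.
- move=> x y z hx hy hz /E H; apply/E; try exact: ljn.
  by move=> i Si ic; apply: (cong_jn (CS i Si)) => //; apply: H.
Qed.

Lemma dist_cong (V : Type) (M : valued V) c : locally_representable M ->
  cong_on M (car M) (fun x y => (dist M x y <= c)%O).
Proof.
move=> gM.
have G x y z : car M x -> car M y -> car M z -> exists X, [/\ X x, X y, X z &
    cong_on M X (fun x y => (dist M x y <= c)%O)].
  move=> hx hy hz.
  have [|X [s XM [_ L [S rS]]]] := gM [set x; y; z] (finite_set3 _ _ _).
    by move=> u [[->|->]|->].
  exists X; split; try (by apply: s; [left; left|left; right|right]).
  - by apply: s; left; left.
  - by apply: s; left; right.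
  - by apply: s; right.
  exact: represents_cong L rS.
split.
- by move=> x hx; have [X [? ? _ C]] := G _ _ _ hx hx hx; apply: (cong_refl C).
- by move=> x y hx hy; have [X [? ? _ C]] := G _ _ _ hx hy hy; apply: (cong_sym C).
- by move=> x y z hx hy hz; have [X [? ? ? C]] := G _ _ _ hx hy hz; apply: (cong_trans C).
- by move=> x y z hx hy hz; have [X [? ? ? C]] := G _ _ _ hx hy hz; apply: (cong_mt C).
- by move=> x y z hx hy hz; have [X [? ? ? C]] := G _ _ _ hx hy hz; apply: (cong_jn C).
Qed.

Lemma dist_compact (V : Type) (M : valued V) x y : algebraic_lattice D ->
  locally_representable M -> car M x -> car M y -> compact_element (dist M x y).
Proof.
move=> hD gM hx hy.
have [|X [s XM [_ L [S [[fS cS] _ kS]]]]] := gM [set x; y] (finite_set2 _ _).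
  by move=> u [->|->].
have Xx : X x by apply: s; left.
have Xy : X y by apply: s; right.
pose B := [set i | S i /\ i.1 (x, y)].
suff -> : dist M x y = dsup hD (snd @` B).
  apply: compact_finite => [|_ [i [Si _] <-]]; last exact: cS.
  by apply: finite_image; apply: sub_finite_set fS => i [].
apply/le_anti/andP; split.
  by apply/kS => // i Si ixy; apply: dsup_ub; exists i.
by apply: dsup_le => _ [i [Si ixy] <-]; move: i Si ixy; apply/kS.
Qed.

Definition pick_or (T : Type) (t : T) (P : set T) : T := @xget {classic T} t P.

Lemma pick_orP (T : Type) (t : T) (P : set T) x : P x ->
  (forall y, P y -> y = x) -> pick_or t P = x.
Proof. by move=> Px u; apply: u; apply: (@xgetI {classic T} t P x). Qed.

(** The values of the operations are determined by any member that contains the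
    arguments; M serves for the values outside and for the bottom. *)
Definition dunion (V : Type) (M : valued V) (F : set (valued V)) : valued V :=
  Valued (\bigcup_(N in F) car N)
    (fun x y => pick_or (mt M x y)
      [set v | exists N, [/\ F N, car N x, car N y & v = mt N x y]])
    (fun x y => pick_or (jn M x y)
      [set v | exists N, [/\ F N, car N x, car N y & v = jn N x y]])
    (fun x y => pick_or (dist M x y)
      [set v | exists N, [/\ F N, car N x, car N y & v = dist N x y]])
    (bot M).

Definition directed (V : Type) (F : set (valued V)) : Prop :=
  forall M N, F M -> F N -> exists P, [/\ F P, ext M P & ext N P].

Lemma dunion_ext (V : Type) (M : valued V) F N : directed F -> F M -> F N ->
  ext N (dunion M F).
Proof.
move=> dF FM FN.
have U T (op : valued V -> V -> V -> T) t x y :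
   (forall P Q, ext P Q -> car P x -> car P y -> op P x y = op Q x y) ->
   car N x -> car N y ->
   op N x y = pick_or t [set v | exists P, [/\ F P, car P x, car P y & v = op P x y]].
  move=> H hx hy; apply/esym/pick_orP; first by exists N.
  move=> _ [P [FP px py ->]]; have [Q [FQ NQ PQ]] := dF _ _ FN FP.
  by rewrite (H _ _ NQ) // (H _ _ PQ).
split=> /=.
- by move=> x hx; exists N.
- by move=> x y hx hy; apply: U => // P Q h px py; apply: (hom_mt h).
- by move=> x y hx hy; apply: U => // P Q h px py; apply: (hom_jn h).
- by move=> x y hx hy; apply: U => // P Q h px py; apply: (hom_dist h).
- have [Q [_ NQ MQ]] := dF _ _ FN FM.
  by rewrite -[LHS]/(id _) (hom_bot NQ) -(hom_bot MQ).
Qed.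

Lemma dunion_locally_representable (V : Type) (M : valued V) F : directed F -> F M ->
  (forall N, F N -> locally_representable N) -> locally_representable (dunion M F).
Proof.
move=> dF FM gF A fA.
have fA' : @finite_set {classic V} A by [].
move/finite_seqP: fA' => [s As] AU.
suff [N FN AN] : exists2 N, F N & A `<=` car N.
  have [X [AX XN rX]] := gF N FN A fA AN.
  have h : hom N X (dunion M F) id.
    by apply: hom_sub XN _; apply: dunion_ext.
  exists X; split=> //; first by move=> x /XN hx; exists N.
  by rewrite -[X]image_id; apply: representable_image rX h.
rewrite {}As in fA AU *; elim: s {fA} AU => [|a s IH] AU; first by exists M.
have [|N FN sN] := IH.
  by move=> x xs; apply: AU; rewrite /= inE xs orbT.
have [P FP aP] : (\bigcup_(N in F) car N) a by apply: AU; rewrite /= mem_head.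
have [Q [FQ NQ PQ]] := dF _ _ FN FP; exists Q => // x /=.
rewrite inE => /orP[/eqP->|xs]; first exact: (hom_car PQ).
by apply: (hom_car NQ); apply: sN.
Qed.

(** Any distance preserving embedding e of M into N can be traded for an
    inclusion: N is copied along f, which undoes e on the image of M and uses
    the fresh names provided by j elsewhere. *)
Lemma extend_into (V V' : Type) (M : valued V) (N : valued V') (e : V -> V') (j : V' -> V) :
  lattice_on M (car M) -> hom M (car M) N e ->
  {in car N &, injective j} -> (forall x, car N x -> ~ car M (j x)) ->
  exists N' f, [/\ ext M N', hom N (car N) N' f, car N' = f @` car N,
    forall x, car M x -> f (e x) = x & car N' `<=` car M `|` j @` car N].
Proof.
move=> L h ij jM.
have /choice[f Hf] : forall v, exists w,
    (exists2 x, car M x & e x = v /\ w = x) \/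
    (~ (exists2 x, car M x & e x = v) /\ w = j v).
  move=> v; have [[x hx xv]|n] := pselect (exists2 x, car M x & e x = v).
    by exists x; left; exists x.
  by exists (j v); right.
have fe x : car M x -> f (e x) = x.
  move=> hx; case: (Hf (e x)) => [[y hy [yx ->]]|[[]]]; last by exists x.
  exact: hom_inj L h _ _ _ _ yx.
have If v v' : car N v -> car N v' -> f v = f v' -> v = v'.
  move=> hv hv'; case: (Hf v) (Hf v') => [[x hx [<- ->]]|[_ ->]].
    by case=> [[y hy [<- ->]] -> //|[_ ->] E]; case: (jM _ hv'); rewrite -E.
  case=> [[y hy [_ ->]] E|[_ ->]]; first by case: (jM _ hv); rewrite E.
  by apply: ij; rewrite inE.
pose g w := pick_or (bot N) [set v | car N v /\ f v = w].
have gf v : car N v -> g (f v) = v.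
  by move=> hv; apply: pick_orP => // u [hu]; apply: If.
pose N' := Valued (f @` car N) (fun x y => f (mt N (g x) (g y)))
  (fun x y => f (jn N (g x) (g y))) (fun x y => dist N (g x) (g y)) (f (bot N)).
have hN : hom N (car N) N' f.
  split=> //=; first by move=> x hx; exists x.
  - by move=> x y hx hy; rewrite !gf.
  - by move=> x y hx hy; rewrite !gf.
  - by move=> x y hx hy; rewrite !gf.
exists N', f; split=> //.
  by apply: (hom_eq L _ (hom_comp h hN)) => x hx /=; rewrite fe.
move=> _ [v hv <-]; case: (Hf v) => [[x hx [_ ->]]|[_ ->]]; first by left.
by right; exists v.
Qed.

End Structures.

(** * The order of a quotient lattice *)
Section QuotientOrder.
Variables (d : Order.disp_t) (D : distrLatticeType d) (V : Type).
Variables (M : valued D V) (X : set V) (R : V -> V -> Prop).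
Hypotheses (L : lattice_on M X) (C : cong_on M X R).

(** The order of the quotient by R, pulled back to representatives; quotients
    are never formed. *)
Definition qle x y := R (mt M x y) x.

Lemma mtxx x : X x -> mt M x x = x.
Proof.
move=> hx; rewrite -{2}(jnmt L hx hx) (mtjn L) //; exact: lmt.
Qed.

Lemma jnxx x : X x -> jn M x x = x.
Proof. by move=> hx; rewrite -{2}(mtjn L hx hx) (jnmt L) //; apply: ljn. Qed.

Lemma qle_mt x y : X x -> mt M x y = x -> qle x y.
Proof. by move=> hx; rewrite /qle => ->; apply: (cong_refl C). Qed.

Lemma qle_refl x : X x -> qle x x.
Proof. by move=> hx; apply: qle_mt; rewrite ?mtxx. Qed.

Lemma qle_trans x y z : X x -> X y -> X z -> qle x y -> qle y z -> qle x z.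
Proof.
move=> hx hy hz xy yz; have hxy := lmt L hx hy; have hyz := lmt L hy hz.
have hxz := lmt L hx hz.
apply: (cong_trans C (y := mt M (mt M x y) z)) => //; first exact: lmt.
  by apply: (cong_mt C) => //; apply: (cong_sym C).
rewrite -(mtA L) // (mtC L) //; apply: (cong_trans C (y := mt M y x)) => //.
- exact: lmt.
- exact: lmt.
- exact: (cong_mt C).
by rewrite (mtC L).
Qed.

Lemma qle_jnl x y : X x -> X y -> qle x (jn M x y).
Proof. by move=> hx hy; apply: qle_mt; rewrite ?(mtjn L). Qed.

Lemma qle_jnr x y : X x -> X y -> qle y (jn M x y).
Proof. by move=> hx hy; rewrite (jnC L) //; apply: qle_jnl. Qed.

Lemma qle_mtl x y : X x -> X y -> qle (mt M x y) x.
Proof.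
move=> hx hy; apply: qle_mt; first exact: lmt.
by rewrite (mtC L) ?(mtA L) ?mtxx //; apply: lmt.
Qed.

Lemma qle_mtr x y : X x -> X y -> qle (mt M x y) y.
Proof. by move=> hx hy; rewrite (mtC L) //; apply: qle_mtl. Qed.

Lemma qle_bot x : X x -> qle (bot M) x.
Proof. by move=> hx; apply: qle_mt; [exact: lbot L|exact: (mt0 L)]. Qed.

Lemma qle_meet x y z : X x -> X y -> X z -> qle z x -> qle z y ->
  qle z (mt M x y).
Proof.
move=> hx hy hz zx zy; rewrite /qle (mtA L) //; have hzx := lmt L hz hx.
apply: (cong_trans C (y := mt M z y)) => //; try exact: lmt.
exact: (cong_mt C).
Qed.

Lemma qle_join x y z : X x -> X y -> X z -> qle x z -> qle y z ->
  qle (jn M x y) z.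
Proof.
have J u v : X u -> X v -> qle u v -> R (jn M u v) v.
  move=> hu hv uv; have huv := lmt L hu hv.
  apply: (cong_trans C (y := jn M (mt M u v) v)) => //; try exact: ljn.
    by apply: (cong_jn C) => //; apply: (cong_sym C).
  rewrite (jnC L) // (mtC L) // (jnmt L) //; exact: (cong_refl C).
move=> hx hy hz xz yz; have hxy := ljn L hx hy; have hxyz := ljn L hxy hz.
have hyz := ljn L hy hz; have hxz := ljn L hx hz.
have E : R (jn M (jn M x y) z) z.
  rewrite -(jnA L) // (jnC L) //; apply: (cong_trans C (y := jn M z x)) => //; try exact: ljn.
    by apply: (cong_jn C) => //; apply: J.
  by rewrite (jnC L) //; apply: J.
rewrite /qle (mtC L) //.
apply: (cong_trans C (y := mt M (jn M (jn M x y) z) (jn M x y))) => //; try exact: lmt.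
  by apply: (cong_mt C) => //; apply: (cong_sym C).
rewrite (mtC L) // (mtjn L) //; exact: (cong_refl C).
Qed.

Lemma qle_anti x y : X x -> X y -> qle x y -> qle y x -> R x y.
Proof.
move=> hx hy xy yx; have hxy := lmt L hx hy.
apply: (cong_trans C (y := mt M x y)) => //; first exact: (cong_sym C).
by rewrite (mtC L).
Qed.

Lemma cong_qle x y : X x -> X y -> R x y -> qle x y.
Proof.
move=> hx hy xy; rewrite /qle (mtC L) // -{2}(mtxx hx).
by apply: (cong_mt C) => //; apply: (cong_sym C).
Qed.

End QuotientOrder.

(** * Amalgamating two quotients by closed sets of points *)

(** The lattices S true and S false share F through the maps e b, and th b is a
    congruence on S b; both congruences restrict to the same one on F. The
    closed sets of points form a lattice which contains both quotients. *)
Section Slice.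
Variables (d : Order.disp_t) (D : distrLatticeType d) (V : Type).
Variables (F : valued D V) (S : bool -> valued D V) (e : bool -> V -> V).
Variable th : bool -> V -> V -> Prop.
Hypothesis LF : lattice_on F (car F).
Hypothesis LS : forall b, lattice_on (S b) (car (S b)).
Hypothesis eF : forall b, hom F (car F) (S b) (e b).
Hypothesis thC : forall b, cong_on (S b) (car (S b)) (th b).
Hypothesis thF : forall b b' x y, car F x -> car F y ->
  th b (e b x) (e b y) -> th b' (e b' x) (e b' y).

Local Notation le b := (qle (S b) (th b)).

(** Besides the elements of the two lattices there are two kinds of points.
    [PCompl b x z] generates a complement, in the interval from x to the join
    of x and z, of every element strictly between its ends. The two points
    [PAtom k] generate the elements q and q' that turn nonzero elements into
    the top. *)
Inductive point := PElt (b : bool) (x : V) | PCompl (b : bool) (x y : V) | PAtom (b : bool).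

Definition all_points : set point := fun t =>
  match t with
  | PElt b x => car (S b) x
  | PCompl b x y => car (S b) x /\ car (S b) y
  | PAtom _ => True
  end.

(** The first fields say that X induces ideals of both quotients which agree on
    F. The rules for [PCompl b x y] place it above x ([cs_compl_low]) and below
    the join of x and y ([cs_compl_top]), and make it generate that join
    together with any z not below x ([cs_compl_join]). *)
Record closed (X : set point) : Prop := Closed {
  cs_points : X `<=` all_points;
  cs_bot : forall b, X (PElt b (bot (S b)));
  cs_jn : forall b x y, X (PElt b x) -> X (PElt b y) -> X (PElt b (jn (S b) x y));
  cs_le : forall b x y, car (S b) x -> X (PElt b y) -> le b x y -> X (PElt b x);
  cs_F : forall b b' x, car F x -> X (PElt b (e b x)) -> X (PElt b' (e b' x));
  cs_compl_low : forall b x y, X (PCompl b x y) -> X (PElt b x);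
  cs_compl_top : forall b x y, car (S b) x -> car (S b) y ->
    X (PElt b (jn (S b) x y)) -> X (PCompl b x y);
  cs_compl_join : forall b x y z, X (PCompl b x y) -> X (PElt b z) -> ~ le b z x ->
    X (PElt b (jn (S b) x y));
  cs_atom : forall k b y, X (PAtom k) -> X (PElt b y) -> ~ th b (bot (S b)) y ->
    all_points `<=` X }.

Lemma closed_all : closed all_points.
Proof.
split=> //=.
- by move=> b; apply: lbot.
- by move=> b x y; apply: ljn.
- by move=> b b' x hx _; apply: (hom_car (eF b')).
- by move=> b x y [].
- by move=> b x y z [hx hy] _ _; apply: ljn.
- by move=> k b y _ _ _ t.
Qed.

Lemma closed_bigcap (A : set (set point)) : A !=set0 -> (forall X, A X -> closed X) ->
  closed (\bigcap_(X in A) X).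
Proof.
move=> [X0 AX0] cA; split.
- by move=> t /(_ _ AX0); apply: (cs_points (cA _ AX0)).
- by move=> b X AX; apply: (cs_bot (cA _ AX)).
- by move=> b x y hx hy X AX; apply: (cs_jn (cA _ AX)); [apply: hx|apply: hy].
- by move=> b x y hx hy xy X AX; apply: (cs_le (cA _ AX) hx _ xy); apply: hy.
- by move=> b b' x hx H X AX; apply: (cs_F (cA _ AX) b' hx); apply: H.
- by move=> b x y H X AX; apply: (cs_compl_low (cA _ AX) (y := y)); apply: H.
- by move=> b x y hx hy H X AX; apply: (cs_compl_top (cA _ AX) hx hy); apply: H.
- by move=> b x y z H Hz zx X AX; apply: (cs_compl_join (cA _ AX) _ _ zx); [apply: H|apply: Hz].
- move=> k b y H Hy ny t tp X AX; apply: (cs_atom (cA _ AX) _ _ ny tp); first exact: (H _ AX).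
  exact: Hy.
Qed.

Definition cl (A : set point) : set point := smallest closed A.

Lemma closed_cl A : A `<=` all_points -> closed (cl A).
Proof.
move=> Ap; apply: closed_bigcap; first by exists all_points; split=> //; apply: closed_all.
by move=> X [].
Qed.

(** The closed set generated by the element h of S b. An element of the other
    lattice belongs to it only because of some f in F between this element and
    h. The first disjunct covers the elements of S b itself; for these it
    subsumes the second one. *)
Definition principal b h : set point :=
  let I b' x := (b = b' /\ le b' x h) \/
    exists f, [/\ car F f, le b' x (e b' f) & le b (e b f) h] in
  fun t => match t with
  | PElt b' x => car (S b') x /\ I b' x
  | PCompl b' x y => [/\ car (S b') x, car (S b') y & I b' (jn (S b') x y)]
  | PAtom _ => False
  end.

Let carE b x : car F x -> car (S b) (e b x).
Proof. exact: (hom_car (eF b)). Qed.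

Lemma principalE b h x : car (S b) h -> principal b h (PElt b x) <-> car (S b) x /\ le b x h.
Proof.
move=> hh; split=> [[hx H]|[hx H]]; split=> //; last by left.
case: H => [[_ //]|[f [hf xf fh]]].
exact: (qle_trans (LS b) (thC b) hx (carE b hf) hh xf fh).
Qed.

Lemma qle_glue b b' x y : car F x -> car F y ->
  le b (e b x) (e b y) -> le b' (e b' x) (e b' y).
Proof.
move=> hx hy; rewrite /qle -!(hom_mt (eF _)) //; apply: thF => //.
exact: lmt.
Qed.

Lemma principal_compl b h b' x y : car (S b') x -> car (S b') y ->
  principal b h (PCompl b' x y) <-> principal b h (PElt b' (jn (S b') x y)).
Proof.
move=> hx hy; split=> [[_ _ H]|[_ H]]; first by split=> //; apply: ljn.
by split.
Qed.

Lemma closed_principal b h : car (S b) h -> closed (principal b h).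
Proof.
move=> hh.
have dn b' x y : car (S b') x -> principal b h (PElt b' y) -> le b' x y ->
    principal b h (PElt b' x).
  move=> hx [hy H] xy; split=> //; case: H => [[bb' yh]|[f [hf yf fh]]]; [left|right].
    by move: bb' yh => <- yh in hx hy xy *; split=> //; apply: (qle_trans (LS b) (thC b) _ hy).
  by exists f; split=> //; apply: (qle_trans (LS b') (thC b') _ hy) => //; apply: carE.
split.
- by case=> [b' x [] | b' x y [] |].
- move=> b'; split; first exact: lbot.
  right; exists (bot F); split; first exact: lbot.
    by rewrite (hom_bot (eF b')); apply: (qle_refl (LS b') (thC b')); apply: lbot.
  by rewrite (hom_bot (eF b)); apply: (qle_bot (LS b) (thC b)).
- move=> b' x y; have [<-|bb'] := pselect (b = b').
    move=> /(principalE _ hh)[hx xh] /(principalE _ hh)[hy yh]; apply/principalE => //.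
    by split; [exact: ljn|exact: (qle_join (LS b) (thC b))].
  move=> [hx [[//]|[f [hf xf fh]]]] [hy [[//]|[g [hg yg gh]]]].
  have hfg := ljn LF hf hg; have hj := ljn (LS b') hx hy.
  split=> //; right; exists (jn F f g); split=> //.
    rewrite (hom_jn (eF b')) //; have hf' := carE b' hf; have hg' := carE b' hg.
    have hj' := ljn (LS b') hf' hg'.
    apply: (qle_join (LS b') (thC b')) => //.
      by apply: (qle_trans (LS b') (thC b') _ hf') => //; apply: (qle_jnl (LS b') (thC b')).
    by apply: (qle_trans (LS b') (thC b') _ hg') => //; apply: (qle_jnr (LS b') (thC b')).
  by rewrite (hom_jn (eF b)) //; apply: (qle_join (LS b) (thC b)) => //; apply: carE.
- exact: dn.
- move=> b1 b2 x hx [_ H]; split; first exact: carE.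
  right; case: H => [[<- xh]|[f [hf xf fh]]].
    by exists x; split=> //; apply: (qle_refl (LS b2) (thC b2)); apply: carE.
  by exists f; split=> //; apply: qle_glue xf.
- move=> b' x y H; have [hx hy _] := H; move/(principal_compl b h hx hy): H => H.
  by apply: dn H _ => //; apply: (qle_jnl (LS b') (thC b')).
- by move=> b' x y hx hy H; apply/principal_compl.
- by move=> b' x y z H _ _; have [hx hy _] := H; apply/principal_compl.
- by [].
Qed.

Lemma principal_least b h X : closed X -> X (PElt b h) -> principal b h `<=` X.
Proof.
move=> cX Xh.
have E b' x : principal b h (PElt b' x) -> X (PElt b' x).
  move=> [hx [[bb' xh]|[f [hf xf fh]]]].
    by move: bb' => <- in hx xh *; apply: (cs_le cX _ Xh).
  apply: (cs_le cX _ _ xf) => //; apply: (cs_F cX (b := b)) => //.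
  by apply: (cs_le cX _ Xh) => //; apply: carE.
case=> [b' x|b' x y H|//]; first exact: E.
have [hx hy _] := H; apply: (cs_compl_top cX) => //; apply: E.
exact/principal_compl.
Qed.

Lemma principal_self b h : car (S b) h -> principal b h (PElt b h).
Proof. by move=> hh; apply/principalE => //; split=> //; apply: (qle_refl (LS b) (thC b)). Qed.

Lemma principal_sub b h X : car (S b) h -> closed X -> principal b h `<=` X <-> X (PElt b h).
Proof.
by move=> hh cX; split=> [|/principal_least]; [apply; apply: principal_self|apply].
Qed.

Lemma principal_subE b x y : car (S b) x -> car (S b) y ->
  principal b x `<=` principal b y <-> le b x y.
Proof.
move=> hx hy; rewrite principal_sub ?principalE //; last exact: closed_principal.
by split=> [[]|].
Qed.

Lemma principal_eq b x y : car (S b) x -> car (S b) y ->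
  principal b x = principal b y <-> th b x y.
Proof.
move=> hx hy; split=> [E|xy].
  by apply: (qle_anti (LS b) (thC b)) => //; apply/principal_subE => //; rewrite E.
apply/seteqP; split; apply/principal_subE => //; apply: (cong_qle (LS b) (thC b)) => //.
exact: (cong_sym (thC b)).
Qed.

Lemma principal_glue b b' f : car F f -> principal b (e b f) = principal b' (e b' f).
Proof.
move=> hf; have H c c' : principal c (e c f) `<=` principal c' (e c' f).
  apply: principal_least; first by apply: closed_principal; apply: carE.
  apply: (cs_F _ (b := c')) => //; first by apply: closed_principal; apply: carE.
  by apply: principal_self; apply: carE.
by apply/seteqP; split; apply: H.
Qed.

Lemma principal_bot b b' : principal b (bot (S b)) = principal b' (bot (S b')).
Proof. by rewrite -!(hom_bot (eF _)); apply: principal_glue; apply: lbot. Qed.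

Lemma principal_bot_least b X : closed X -> principal b (bot (S b)) `<=` X.
Proof. by move=> cX; apply: principal_least => //; apply: cs_bot. Qed.

Lemma principal_meet b x y : car (S b) x -> car (S b) y ->
  principal b (mt (S b) x y) = principal b x `&` principal b y.
Proof.
move=> hx hy; have hm := lmt (LS b) hx hy.
apply/seteqP; split.
  rewrite subsetI; split; apply/principal_subE => //.
    exact: (qle_mtl (LS b) (thC b)).
  exact: (qle_mtr (LS b) (thC b)).
have E b' z : principal b x (PElt b' z) -> principal b y (PElt b' z) ->
    principal b (mt (S b) x y) (PElt b' z).
  have [<-|bb'] := pselect (b = b').
    move=> /(principalE _ hx)[hz zx] /(principalE _ hy)[_ zy]; apply/principalE => //.
    by split=> //; apply: (qle_meet (LS b) (thC b)).
  move=> [hz [[//]|[f [hf zf fx]]]] [_ [[//]|[g [hg zg gy]]]].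
  have hfg := lmt LF hf hg; split=> //; right; exists (mt F f g); split=> //.
    by rewrite (hom_mt (eF b')) //; apply: (qle_meet (LS b') (thC b')) => //; apply: carE.
  rewrite (hom_mt (eF b)) //; have hf' := carE b hf; have hg' := carE b hg.
  have hm' := lmt (LS b) hf' hg'.
  apply: (qle_meet (LS b) (thC b)) => //.
    by apply: (qle_trans (LS b) (thC b) _ hf') => //; apply: (qle_mtl (LS b) (thC b)).
  by apply: (qle_trans (LS b) (thC b) _ hg') => //; apply: (qle_mtr (LS b) (thC b)).
case=> [b' z [zx zy]|b' z z' [zx zy]|k []//]; first exact: E.
have [hz hz' _] := zx; apply/principal_compl => //; apply: E; exact/principal_compl.
Qed.

Lemma principal_points b h : car (S b) h -> principal b h `<=` all_points.
Proof. by move=> /closed_principal/cs_points. Qed.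

Lemma principal_join b x y : car (S b) x -> car (S b) y ->
  principal b (jn (S b) x y) = cl (principal b x `|` principal b y).
Proof.
move=> hx hy; have hj := ljn (LS b) hx hy.
apply/seteqP; split.
  have cc : closed (cl (principal b x `|` principal b y)).
    by apply: closed_cl; rewrite subUset; split; apply: principal_points.
  apply: principal_least => //; apply: (cs_jn cc); apply: sub_gen_smallest; [left|right];
    exact: principal_self.
apply: smallest_sub; first exact: closed_principal.
rewrite subUset; split; apply/principal_subE => //.
  exact: (qle_jnl (LS b) (thC b)).
exact: (qle_jnr (LS b) (thC b)).
Qed.

(** If x < y < z in the quotient, then adding the single point [PCompl b x z]
    to the closed set of x gives a closed set. It meets the closed set of y in
    that of x, and together with y it generates z. If y is identified with an
    end of the interval, the opposite end is a complement. *)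
Lemma principal_complement b x y z : car (S b) x -> car (S b) y -> car (S b) z ->
  mt (S b) x y = x -> mt (S b) y z = y ->
  exists W, [/\ closed W, principal b y `&` W = principal b x &
    cl (principal b y `|` W) = principal b z].
Proof.
move=> hx hy hz xy yz.
have jyx : jn (S b) y x = y by rewrite -xy (mtC (LS b)) // (jnmt (LS b)).
have jyz : jn (S b) y z = z.
  by rewrite -{1}yz (jnC (LS b)) ?(mtC (LS b) hy) ?(jnmt (LS b)) //; apply: lmt.
have xz : mt (S b) x z = x by rewrite -{1}xy -(mtA (LS b)) // yz.
have jxz : jn (S b) x z = z.
  by rewrite -{1}xz (jnC (LS b)) ?(mtC (LS b) hx) ?(jnmt (LS b)) //; apply: lmt.
have myx : mt (S b) y x = x by rewrite (mtC (LS b)).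
have [zy|nzy] := pselect (le b z y).
  have Ez : principal b z = principal b y.
    apply/principal_eq => //; apply: (qle_anti (LS b) (thC b)) => //.
    exact: (qle_mt (thC b)).
  exists (principal b x); split; first exact: closed_principal.
    by rewrite -principal_meet // myx.
  by rewrite -principal_join // jyx Ez.
have [yx|nyx] := pselect (le b y x).
  have Ey : principal b y = principal b x.
    apply/principal_eq => //; apply: (qle_anti (LS b) (thC b)) => //.
    exact: (qle_mt (thC b)).
  exists (principal b z); split; first exact: closed_principal.
    by rewrite -principal_meet // yz.
  by rewrite -principal_join // jyz.
pose W : set point := principal b x `|` [set PCompl b x z].
have cx := closed_principal hx.
have WE b' u : W (PElt b' u) -> principal b x (PElt b' u) by case.
have cW : closed W.
  split.
  - by move=> t [/(cs_points cx)//|->].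
  - by move=> b'; left; apply: (cs_bot cx).
  - by move=> b' u v /WE hu /WE hv; left; apply: (cs_jn cx).
  - by move=> b' u v hu /WE hv uv; left; apply: (cs_le cx hu hv uv).
  - by move=> b1 b2 u hu /WE H; left; apply: (cs_F cx _ hu H).
  - move=> b' u v [H|[-> -> _]]; left; first exact: (cs_compl_low cx H).
    exact: principal_self.
  - by move=> b' u v hu hv /WE H; left; apply: (cs_compl_top cx).
  - move=> b' u v w [H /WE H' n|[-> -> _] /WE /(principalE _ hx)[]//].
    by left; apply: (cs_compl_join cx H H').
  - by move=> k b' u [|].
exists W; split=> //.
  rewrite setIUr -principal_meet // myx; apply/seteqP; split; last by move=> t; left.
  move=> t [//|[+ tE]]; rewrite {}tE => /(principal_compl b y hx hz).
  by rewrite jxz => /(principalE _ hy)[].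
have cc : closed (cl (principal b y `|` W)).
  by apply: closed_cl; rewrite subUset; split; [exact: principal_points|exact: cs_points cW].
have sub : principal b y `|` W `<=` cl (principal b y `|` W) by apply: sub_gen_smallest.
apply/seteqP; split.
  apply: smallest_sub; first exact: closed_principal.
  rewrite !subUset; split; first by apply/principal_subE => //; apply: (qle_mt (thC b)).
  split; first by apply/principal_subE => //; apply: (qle_mt (thC b)).
  by move=> _ ->; apply/principal_compl => //; rewrite jxz; apply: principal_self.
apply: principal_least => //; rewrite -jxz; apply: (cs_compl_join cc (z := y)) => //.
  by apply: sub; right; right.
by apply: sub; left; apply: principal_self.
Qed.

(** The point [PAtom k] alone generates nothing but the least closed set. *)
Definition atom k : set point := principal true (bot (S true)) `|` [set PAtom k].

Let cbot b : closed (principal b (bot (S b))).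
Proof. by apply: closed_principal; apply: lbot. Qed.

Lemma principal_bot_cong b b' y : principal b (bot (S b)) (PElt b' y) -> th b' (bot (S b')) y.
Proof.
have hb := lbot (LS b').
rewrite (principal_bot b b') => /(principalE _ hb)[hy yb].
by apply: (qle_anti (LS b') (thC b')) => //; apply: (qle_bot (LS b') (thC b')).
Qed.

Lemma closed_atom k : closed (atom k).
Proof.
have cx := cbot true.
have WE b' u : atom k (PElt b' u) -> principal true (bot (S true)) (PElt b' u) by case.
split.
- by move=> t [/(cs_points cx)//|->].
- by move=> b'; left; apply: (cs_bot cx).
- by move=> b' u v /WE hu /WE hv; left; apply: (cs_jn cx).
- by move=> b' u v hu /WE hv uv; left; apply: (cs_le cx hu hv uv).
- by move=> b1 b2 u hu /WE H; left; apply: (cs_F cx _ hu H).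
- by move=> b' u v [H|//]; left; apply: (cs_compl_low cx H).
- by move=> b' u v hu hv /WE H; left; apply: (cs_compl_top cx).
- by move=> b' u v w [H|//] /WE H' n; left; apply: (cs_compl_join cx H H').
- by move=> k' b' u _ /WE /principal_bot_cong.
Qed.

Lemma atom_meet b : atom true `&` atom false = principal b (bot (S b)).
Proof.
rewrite (principal_bot b true) /atom -setUIr; apply/seteqP; split; last by move=> t; left.
by move=> t [//|[->]].
Qed.

(** If y is not identified with the bottom, then the join on the right is the
    whole set of points. Otherwise x is identified with the bottom too. *)
Lemma atom_join b x y k : car (S b) x -> car (S b) y ->
  (th b (bot (S b)) y -> th b (bot (S b)) x) ->
  principal b x `<=` cl (atom k `|` principal b y).
Proof.
move=> hx hy H.
have cc : closed (cl (atom k `|` principal b y)).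
  apply: closed_cl; rewrite subUset; split; last exact: principal_points.
  exact: cs_points (closed_atom k).
have [/H bx|ny] := pselect (th b (bot (S b)) y).
  have -> : principal b x = principal b (bot (S b)).
    by apply/esym/principal_eq => //; apply: lbot.
  exact: principal_bot_least.
apply: subset_trans (principal_points hx) _; apply: (cs_atom cc (k := k) _ _ ny).
  by apply: sub_gen_smallest; left; right.
by apply: sub_gen_smallest; right; apply: principal_self.
Qed.

Lemma principal_bot_proper b : principal b (bot (S b)) <> all_points.
Proof. by move=> E; have : all_points (PAtom true) by []; rewrite -E. Qed.

End Slice.

(** * The product over all weighted congruences *)
Lemma finite_subsets (T : Type) (A : set T) :
  finite_set A -> finite_set [set X : set T | X `<=` A].
Proof.
move=> /(@finite_seqP {classic T})[s As].
pose f (m : (size s).-tuple bool) : set T := [set` mask m (s : seq {classic T})].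
apply: sub_finite_set (finite_image f (@finite_finset _ setT)) => X /= XA.
pose m := map (fun x : {classic T} => `[< X x >]) s.
have sm : size m == size s by rewrite size_map.
exists (Tuple sm) => //; rewrite /f /= -filter_mask.
apply/seteqP; split=> x /=; rewrite mem_filter; first by move=> /andP[/asboolP].
by move=> Xx; apply/andP; split; [apply/asboolP|have := XA _ Xx; rewrite As].
Qed.

Section Product.
Variables (d : Order.disp_t) (D : distrLatticeType d) (V : Type).
Hypothesis hD : algebraic_lattice D.
Variables (F : valued D V) (S : bool -> valued D V) (e : bool -> V -> V).
Variable G : set (set (bool * (V * V)) * D).
Hypothesis LF : lattice_on F (car F).
Hypothesis rS : forall b, representable (S b) (car (S b)).
Hypothesis eF : forall b, hom F (car F) (S b) (e b).
Let I := {i : set (bool * (V * V)) * D | G i}.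
(** Each weighted set i carries one congruence for each of the two lattices: the
    boolean tag tells which lattice a pair comes from. *)
Definition cong_of (i : set (bool * (V * V)) * D) b x y := ~ i.1 (b, (x, y)).
Hypothesis sG : system G.
(* Weights differ from the least element, so that two tuples at distance zero
   agree in every coordinate. *)
Hypothesis nG : forall i, G i -> exists c, ~ (i.2 <= c)%O.
Hypothesis cG : forall i b, G i -> cong_on (S b) (car (S b)) (cong_of i b).
Hypothesis FG : forall i b b' x y, G i -> car F x -> car F y ->
  cong_of i b (e b x) (e b y) -> cong_of i b' (e b' x) (e b' y).

Let LS b : lattice_on (S b) (car (S b)).
Proof. by have [] := rS b. Qed.

Let c_ (i : I) : forall b, cong_on (S b) (car (S b)) (cong_of (sval i) b).
Proof. by move=> b; apply: cG; apply: svalP. Qed.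

Let F_ (i : I) : forall b b' x y, car F x -> car F y ->
  cong_of (sval i) b (e b x) (e b y) -> cong_of (sval i) b' (e b' x) (e b' y).
Proof. by move=> b b' x y; apply: FG; apply: svalP. Qed.

Let cs (i : I) := closed F S e (cong_of (sval i)).
Let cli (i : I) := cl F S e (cong_of (sval i)).
Let em (i : I) := principal F S e (cong_of (sval i)).

(** Tuples of closed sets, with pointwise operations. Their distance is Boolean
    by construction, since it joins the weights of the coordinates in which two
    tuples differ. *)
Definition closed_product : valued D (I -> set (point V)) :=
  Valued (fun X => forall i, cs i (X i))
    (fun X Y i => X i `&` Y i)
    (fun X Y i => cli i (X i `|` Y i))
    (fun X Y => dsup hD ((fun i : I => (sval i).2) @` [set i | X i <> Y i]))
    (fun i => em i true (bot (S true))).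

Lemma dist_product X Y c : (dist closed_product X Y <= c)%O <->
  forall i, X i <> Y i -> ((sval i).2 <= c)%O.
Proof.
split=> [h i ni|H].
  by apply: le_trans h; apply: dsup_ub; exists i.
by apply: dsup_le => _ [i ni <-]; apply: H.
Qed.

Lemma finite_points : finite_set (all_points S).
Proof.
have fS b : finite_set (car (S b)) by have [] := rS b.
pose T : set bool := setT.
have fT : finite_set T by apply: finite_finset.
pose Y := car (S true) `|` car (S false).
have fY : finite_set Y by rewrite finite_setU.
have YS b x : car (S b) x -> Y x by case: b; [left|right].
apply: (@sub_finite_set _ _ ((fun p => PElt p.1 p.2) @` (T `*` Y) `|`
  (fun p => PCompl p.1 p.2.1 p.2.2) @` (T `*` (Y `*` Y)) `|` (@PAtom V) @` T)).
  case=> [b x /= hx|b x y /= [hx hy]|b _].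
  - by left; left; exists (b, x) => //; split=> //; apply: YS hx.
  - left; right; exists (b, (x, y)) => //; split=> //; split=> /=.
      exact: YS hx.
    exact: YS hy.
  by right; exists b.
rewrite !finite_setU; split; first split; apply: finite_image => //.
  exact: finite_setX.
by do 2!apply: finite_setX => //.
Qed.

Lemma closed_product_representable : representable closed_product (car closed_product).
Proof.
have cle i A B : A `<=` B -> B `<=` all_points S -> cli i A `<=` cli i B.
  move=> AB Bp; apply: smallest_sub; first exact: (closed_cl _ LS eF).
  by apply: subset_trans AB _; apply: sub_gen_smallest.
have ccl i X Y : cs i X -> cs i Y -> cs i (cli i (X `|` Y)).
  by move=> hX hY; apply: (closed_cl _ LS eF); rewrite subUset; split; apply: cs_points; eauto.
have clU i X Y Z : cs i X -> cs i Y -> cs i Z ->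
    cli i (X `|` cli i (Y `|` Z)) = cli i (X `|` (Y `|` Z)).
  move=> hX hY hZ; have hYZ := ccl _ _ _ hY hZ.
  have hp : X `|` (Y `|` Z) `<=` all_points S.
    by rewrite !subUset; split; [|split]; apply: cs_points; eauto.
  apply/seteqP; split.
    apply: smallest_sub; first exact: (closed_cl _ LS eF).
    rewrite subUset; split.
      by apply: subset_trans; last exact: sub_gen_smallest; apply: subsetUl.
    by apply: cle => //; apply: subsetUr.
  apply: cle; last by rewrite subUset; split; apply: cs_points; eauto.
  by apply: setUS; apply: sub_gen_smallest.
split.
- pose h (X : I -> set (point V)) : set ((set (bool * (V * V)) * D) * point V) :=
    [set p | exists i : I, sval i = p.1 /\ X i p.2].
  have hI X Y : h X = h Y -> X = Y.
    move=> E; apply/funext => i; apply/seteqP; split=> t Xt.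
      have : h X (sval i, t) by exists i.
      by rewrite E => -[i' [/= /eq_sig_hprop <- //]]; move=> *; exact: Prop_irrelevance.
    have : h Y (sval i, t) by exists i.
    by rewrite -E => -[i' [/= /eq_sig_hprop <- //]]; move=> *; exact: Prop_irrelevance.
  have fP : finite_set (h @` car closed_product).
    apply: sub_finite_set (finite_subsets (finite_setX (proj1 sG) finite_points)).
    move=> _ [X hX <-] [i t] [j [/= ji Xt]]; split=> /=; first by rewrite -ji; apply: svalP.
    exact: (cs_points (hX j)).
  have /choice[g Hg] : forall A, exists X, forall Y, h Y = A -> Y = X.
    move=> A; have [[X XA]|n] := pselect (exists X, h X = A).
      by exists X => Y YA; apply: hI; rewrite YA.
    by exists (bot closed_product) => Y YA; case: n; exists Y.
  apply: sub_finite_set (finite_image g fP) => X hX.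
  by exists (h X); [exists X|apply/esym/Hg].
- split=> /=.
  + by move=> i; apply: (closed_principal LF LS eF (c_ i) (@F_ i)); apply: lbot.
  + move=> X Y hX hY i.
    have -> : X i `&` Y i = \bigcap_(Z in [set X i; Y i]) Z.
      apply/seteqP; split=> [t [Xt Yt] _ [->|->] //|t H].
      by split; apply: H; [left|right].
    apply: closed_bigcap; first by exists (X i); left.
    by move=> _ [->|->]; [apply: hX|apply: hY].
  + by move=> X Y hX hY i; apply: ccl.
  + by move=> X Y _ _; apply/funext => i; rewrite setIC.
  + by move=> X Y _ _; apply/funext => i; rewrite setUC.
  + by move=> X Y Z _ _ _; apply/funext => i; rewrite setIA.
  + move=> X Y Z hX hY hZ; apply/funext => i.
    rewrite clU // (setUC (cli i _)) clU //.
    by congr (cli i _); rewrite [RHS]setUC setUA.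
  + move=> X Y hX hY; apply/funext => i.
    have -> : X i `|` (X i `&` Y i) = X i by apply: setUidl; exact: subIsetl.
    exact: smallest_id (hX i).
  + move=> X Y hX hY; apply/funext => i; apply/setIidPl.
    by apply: subset_trans; last exact: sub_gen_smallest; apply: subsetUl.
  + move=> X hX; apply/funext => i; apply/setIidPl.
    exact: (principal_bot_least LS eF (hX i)).
  + move=> X Y hX hY; split=> [H|->]; last by move=> c; apply/dist_product.
    apply/funext => i; apply: contrapT => ni.
    by have [c] := nG (svalP i); apply; have /dist_product := H c; apply.
pose im (i : set (bool * (V * V)) * D) :
   set ((I -> set (point V)) * (I -> set (point V))) * D :=
  ([set p | exists j : I, sval j = i /\ p.1 j <> p.2 j], i.2).
have imE (i : I) X Y : (im (sval i)).1 (X, Y) <-> X i <> Y i.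
  split=> [[j [/eq_sig_hprop E /=]]|n]; last by exists i.
  by rewrite E // => *; apply: Prop_irrelevance.
exists (im @` G); split.
- split; first exact: finite_image (proj1 sG).
  by move=> _ [i Gi <-] /=; apply: (proj2 sG).
- move=> _ [i Gi <-]; pose i' : I := exist _ i Gi.
  have imN X Y : ~ (im i).1 (X, Y) <-> X i' = Y i'.
    by rewrite (imE i'); split=> [/contrapT|-> []].
  split.
  + by move=> X _; apply/imN.
  + by move=> X Y _ _ /imN E; apply/imN.
  + by move=> X Y Z _ _ _ /imN E /imN E'; apply/imN; rewrite E.
  + by move=> X Y Z _ _ _ /imN E; apply/imN; rewrite /= E.
  + by move=> X Y Z _ _ _ /imN E; apply/imN; rewrite /= E.
move=> X Y c _ _; rewrite dist_product; split=> H.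
  move=> _ [i Gi <-] /(imE (exist _ i Gi)) ni; exact: (H _ ni).
move=> i ni; apply: (H (im (sval i))); last exact/imE.
by exists (sval i) => //; apply: svalP.
Qed.

Definition principal_product b x : I -> set (point V) := fun i => em i b x.

Lemma principal_product_hom b :
  (forall x y c, car (S b) x -> car (S b) y ->
    (dist (S b) x y <= c)%O <-> value_le G (b, (x, y)) c) ->
  hom (S b) (car (S b)) closed_product (principal_product b).
Proof.
move=> kG; split.
- by move=> x hx i; apply: (closed_principal LF LS eF (c_ i) (@F_ i)).
- by move=> x y hx hy; apply/funext => i; apply: (principal_meet LF LS eF (c_ i) (@F_ i)).
- by move=> x y hx hy; apply/funext => i; apply: (principal_join LF LS eF (c_ i) (@F_ i)).
- move=> x y hx hy.
  have E c : (dist (S b) x y <= c)%O <->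
      (dist closed_product (principal_product b x) (principal_product b y) <= c)%O.
    rewrite dist_product kG //; split=> H.
      move=> i ni; apply: (H _ (svalP i)); apply: contrapT => n.
      by apply: ni; apply/(principal_eq LF LS eF (c_ i) (@F_ i)).
    move=> i Gi ixy; apply: (H (exist _ i Gi)) => /=.
    by move/(principal_eq LF LS eF (c_ (exist _ i Gi)) (@F_ (exist _ i Gi)) hx hy).
  by apply/le_anti/andP; split; apply/E.
- apply/funext => i; exact: (principal_bot LF LS eF (c_ i) (@F_ i)).
Qed.

End Product.

(** * Amalgamation of finite lattices *)
Section Amalgam.
Variables (d : Order.disp_t) (D : distrLatticeType d).
Hypothesis hD : algebraic_lattice D.

(** P contains, for the image of X, the elements that the final lattice has to
    contain. The second field provides the witnesses q and q' for mu x <= mu y;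
    its last equation says that x lies below (q \/ y) /\ (q' \/ y). *)
Record solves (V V' : Type) (M : valued D V) (X : set V) (P : valued D V')
    (f : V -> V') : Prop := Solves {
  solves_compl : forall x y z, X x -> X y -> X z ->
    mt M x y = x -> mt M y z = y ->
    exists2 w, car P w & mt P (f y) w = f x /\ jn P (f y) w = f z;
  solves_gen : forall x y, X x -> X y ->
    (dist M (bot M) x <= dist M (bot M) y)%O ->
    exists q q', [/\ car P q, car P q', mt P q q' = bot P &
      mt P (f x) (mt P (jn P q (f y)) (jn P q' (f y))) = f x] }.

Lemma solves_comp (V V' V'' : Type) (M : valued D V) X (N : valued D V')
    (P : valued D V'') (f : V -> V') (g : V' -> V'') :
  lattice_on N (car N) -> solves M X N f -> hom M X N f -> hom N (car N) P g ->
  solves M X P (g \o f).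
Proof.
move=> L [h1 h2] hf hg; split.
  move=> x y z hx hy hz xy yz; have [w hw [wx wz]] := h1 x y z hx hy hz xy yz.
  have hfy := hom_car hf hy.
  exists (g w); first exact: (hom_car hg).
  by rewrite /= -(hom_mt hg) // -(hom_jn hg) // wx wz.
move=> x y hx hy xy; have [q [q' [hq hq' qq E]]] := h2 x y hx hy xy.
have hfx := hom_car hf hx; have hfy := hom_car hf hy.
have j := ljn L hq hfy; have j' := ljn L hq' hfy; have m := lmt L j j'.
exists (g q), (g q'); split; try exact: (hom_car hg).
  by rewrite -(hom_mt hg) // qq (hom_bot hg).
by rewrite /= -!(hom_jn hg) // -!(hom_mt hg) // E.
Qed.

Lemma cong_on_iff (V : Type) (M : valued D V) X (R R' : V -> V -> Prop) :
  (forall x y, R x y <-> R' x y) -> cong_on M X R -> cong_on M X R'.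
Proof.
move=> E; suff -> : R = R' by [].
by apply/funext => x; apply/funext => y; apply/propext.
Qed.

Lemma cong_onI (V : Type) (M : valued D V) X (R R' : V -> V -> Prop) :
  cong_on M X R -> cong_on M X R' -> cong_on M X (fun x y => R x y /\ R' x y).
Proof.
move=> C C'; split.
- by move=> x hx; split; [apply: (cong_refl C)|apply: (cong_refl C')].
- by move=> x y hx hy [h h']; split; [apply: (cong_sym C)|apply: (cong_sym C')].
- move=> x y z hx hy hz [h h'] [k k'].
  by split; [apply: (cong_trans C (y := y))|apply: (cong_trans C' (y := y))].
- by move=> x y z hx hy hz [h h']; split; [apply: (cong_mt C)|apply: (cong_mt C')].
- by move=> x y z hx hy hz [h h']; split; [apply: (cong_jn C)|apply: (cong_jn C')].
Qed.

Lemma cong_onT (V : Type) (M : valued D V) X (R : V -> V -> Prop) :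
  (forall x y, R x y) -> cong_on M X R.
Proof. by move=> H; split. Qed.

(** The weighted congruences of the two lattices are put together by letting
    those of one lattice identify everything in the other. This system is
    refined so that, for every weighted congruence, the relations on S true and
    S false agree on F and whenever mu x <= mu y, the zero class contains x if
    it contains y. The amalgam is the product of the lattices of closed sets
    over all nonzero weights. The value s0 comes from one more coordinate of
    weight s0, in which the two lattices collapse to a point: the tuple that is
    the full set there and least elsewhere has distance s0 from the bottom. *)
Lemma amalgamation (V : Type) (F : valued D V) (S : bool -> valued D V)
    (e : bool -> V -> V) (s0 : D) :
  finite_set (car F) -> lattice_on F (car F) ->
  (forall b, representable (S b) (car (S b))) ->
  (forall b, hom F (car F) (S b) (e b)) -> compact_element s0 ->
  exists (V' : Type) (P : valued D V') (a : bool -> V -> V'),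
  [/\ representable P (car P), forall b, hom (S b) (car (S b)) P (a b),
    forall b b' x, car F x -> a b (e b x) = a b' (e b' x),
    forall b, solves (S b) (car (S b)) P (a b) &
    exists2 z, car P z & dist P (bot P) z = s0].
Proof.
move=> fF LF rS eF cs0.
have LS b : lattice_on (S b) (car (S b)) by have [] := rS b.
have /choice[T rT] : forall b, exists T, represents (S b) (car (S b)) T.
  by move=> b; have [] := rS b.
pose lift b (i : set (V * V) * D) : set (bool * (V * V)) * D :=
  ([set q | q.1 = b /\ i.1 q.2], i.2).
pose G0 := lift true @` T true `|` lift false @` T false.
have G0E i : G0 i <-> exists b j, T b j /\ i = lift b j.
  split=> [[[j Tj <-]|[j Tj <-]]|[[] [j [Tj ->]]]].
  - by exists true, j.
  - by exists false, j.
  - by left; exists j.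
  - by right; exists j.
have v0 b x y c : car (S b) x -> car (S b) y ->
    (dist (S b) x y <= c)%O <-> value_le G0 (b, (x, y)) c.
  move=> hx hy; have [_ _ ->] := rT b => //; split=> H.
    by move=> i /G0E [b' [j [Tj ->]]] /= [bb' jxy]; subst b'; apply: H jxy.
  move=> j Tj jxy; apply: (H (lift b j)) => //; apply/G0E; by exists b, j.
have s_0 : system G0.
  split.
    by rewrite finite_setU; split; apply: finite_image; have [[]] := rT true;
      have [[]] := rT false.
  move=> i /G0E[b [j [Tj ->]]] /=; have [[_ cT] _ _] := rT b; exact: cT.
pose C (A : set (bool * (V * V))) :=
  forall b, cong_on (S b) (car (S b)) (fun x y => ~ A (b, (x, y))).
have CU A B : C A -> C B -> C (A `|` B).
  move=> hA hB b; apply: cong_on_iff (cong_onI (hA b) (hB b)) => x y.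
  by split=> [[nA nB] []|n]; [exact: nA|exact: nB|split=> h; apply: n; [left|right]].
have C0 i : G0 i -> C i.1.
  move=> /G0E[b [j [Tj ->]]] b' /=.
  have [->|n] := pselect (b' = b).
    have [_ cT _] := rT b; apply: cong_on_iff (cT j Tj) => x y.
    by split=> [n [_ /n]|n h]; last apply: n.
  by apply: cong_onT => x y [].
(* The first requirements make the congruences agree on F, where the distances
   agree; both directions are there because b and b' are arbitrary. *)
pose R : set ((bool * (V * V)) * (bool * (V * V))) := [set p |
  (exists b b' x y, [/\ car F x, car F y &
     p = ((b, (e b x, e b y)), (b', (e b' x, e b' y)))]) \/
  exists b x y, [/\ car (S b) x, car (S b) y,
     (dist (S b) (bot (S b)) x <= dist (S b) (bot (S b)) y)%O &
     p = ((b, (bot (S b), x)), (b, (bot (S b), y)))]].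
have fR : finite_set R.
  pose Y := car (S true) `|` car (S false).
  have fS b : finite_set (car (S b)) by have [] := rS b.
  have fY : finite_set Y by rewrite finite_setU.
  have YS b x : car (S b) x -> Y x by case: b; [left|right].
  have fB : finite_set [set: bool] by apply: finite_finset.
  have fQ : finite_set ([set: bool] `*` (Y `*` Y)) by do 2!apply: finite_setX => //.
  apply: sub_finite_set (finite_setX fQ fQ).
  move=> _ [[b [b' [x [y [hx hy ->]]]]]|[b [x [y [hx hy _ ->]]]]]; split; split=> //;
    split=> /=.
  - exact: YS (hom_car (eF b) hx).
  - exact: YS (hom_car (eF b) hy).
  - exact: YS (hom_car (eF b') hx).
  - exact: YS (hom_car (eF b') hy).
  - exact: YS (lbot (LS b)).
  - exact: YS hx.
  - exact: YS (lbot (LS b)).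
  - exact: YS hy.
have vR p c : R p -> value_le G0 p.2 c -> value_le G0 p.1 c.
  move=> [[b [b' [x [y [hx hy ->]]]]]|[b [x [y [hx hy xy ->]]]]] /=.
    move=> /v0 H; apply/v0; try exact: (hom_car (eF b)).
    by rewrite -(hom_dist (eF b)) // (hom_dist (eF b')) //; apply: H; apply: (hom_car (eF b')).
  have hb := lbot (LS b).
  by move=> /(v0 b _ _ _ hb hy) H; apply/v0 => //; apply: le_trans xy H.
have [G1 [s1 v1 r1 C1]] := refine_system hD s_0 fR vR CU C0.
(* The coordinate (set0, s0) has the total congruences and contributes nothing
   to the old distances. *)
pose G : set (set (bool * (V * V)) * D) :=
  [set i | (G1 i \/ i = (set0, s0)) /\ exists c, ~ (i.2 <= c)%O].
have vG q c : value_le G q c <-> value_le G1 q c.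
  split=> H i.
    move=> Gi iq; apply: contrapT => n; apply: (n); apply: (H i) => //.
    by split; [left|exists c].
  by move=> [[Gi|->//] _]; apply: H.
have sG : system G.
  split.
    apply: (@sub_finite_set _ _ (G1 `|` [set (set0, s0)])); first by move=> i [].
    by rewrite finite_setU; split; [exact: (proj1 s1)|exact: finite_set1].
  by move=> i [[/(proj2 s1)//|->//] _].
have nG i : G i -> exists c, ~ (i.2 <= c)%O by case.
have cG i b : G i -> cong_on (S b) (car (S b)) (cong_of i b).
  by move=> [[/C1//|->] _]; apply: cong_onT => x y [].
have rG i p : G i -> R p -> i.1 p.1 -> i.1 p.2.
  by move=> [[Gi|->] _] Rp h; [exact: r1 Gi Rp h|case: h].
have FG i b b' x y : G i -> car F x -> car F y ->
    cong_of i b (e b x) (e b y) -> cong_of i b' (e b' x) (e b' y).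
  move=> Gi hx hy n h; apply: n.
  apply: (rG i ((b', (e b' x, e b' y)), (b, (e b x, e b y))) Gi) => //.
  by left; exists b', b, x, y.
have c_ (i : {i | G i}) : forall b, cong_on (S b) (car (S b)) (cong_of (sval i) b).
  by move=> b; apply: cG; apply: svalP.
have F_ (i : {i | G i}) b b' x y : car F x -> car F y ->
    cong_of (sval i) b (e b x) (e b y) -> cong_of (sval i) b' (e b' x) (e b' y).
  by apply: FG; apply: svalP.
have hem b : hom (S b) (car (S b)) (closed_product hD F S e G) (principal_product F S e (G := G) b).
  apply: (principal_product_hom hD LF rS eF cG FG) => x y c hx hy.
  by rewrite vG v1; apply: v0.
exists ({i | G i} -> set (point V)), (closed_product hD F S e G),
  (principal_product F S e (G := G)).
split=> //.
- exact: (closed_product_representable hD LF rS eF sG nG cG FG).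
- by move=> b b' x hx; apply/funext => i; apply: (principal_glue LF LS eF (c_ i) (@F_ i)).
- move=> b; split.
    move=> x y z hx hy hz xy yz.
    have /choice[w Hw] := fun i : {i | G i} =>
      principal_complement LF LS eF (c_ i) (@F_ i) hx hy hz xy yz.
    exists w; first by move=> i; case: (Hw i).
    by split; apply/funext => i; case: (Hw i).
  move=> x y hx hy xy.
  pose q k (i : {i | G i}) := atom F S e (cong_of (sval i)) k.
  have hq k i : closed F S e (cong_of (sval i)) (q k i).
    exact: (closed_atom LF LS eF (c_ i) (@F_ i)).
  exists (q true), (q false); split=> //.
    by apply/funext => i; apply: (atom_meet LF LS eF (c_ i) (@F_ i)).
  apply/funext => i; apply/setIidPl.
  have Hi : cong_of (sval i) b (bot (S b)) y -> cong_of (sval i) b (bot (S b)) x.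
    move=> n h; apply: n.
    apply: (rG (sval i) ((b, (bot (S b), x)), (b, (bot (S b), y))) (svalP i)) => //.
    by right; exists b, x, y.
  by rewrite subsetI; split; apply: (atom_join LF LS eF (c_ i) (@F_ i)).
have LP : lattice_on (closed_product hD F S e G) (car (closed_product hD F S e G)).
  by have [] := closed_product_representable hD LF rS eF sG nG cG FG.
have [n0|nn] := pselect (exists c, ~ (s0 <= c)%O); last first.
  have z0 c : (s0 <= c)%O by apply: contrapT => n; apply: nn; exists c.
  exists (bot (closed_product hD F S e G)); first exact: (lbot LP).
  apply/le_anti; rewrite z0 andbT.
  by apply: (dist_eq0 LP (lbot LP) (lbot LP)).2.
have G0i : G (set0, s0) by split=> //; right.
pose i0 : {i | G i} := exist _ _ G0i.
pose z (i : {i | G i}) : set (point V) :=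
  if pselect (i = i0) then all_points S else principal F S e (cong_of (sval i)) true (bot (S true)).
exists z.
  move=> i; rewrite /z; case: pselect => ? /=; first exact: (closed_all _ LS eF).
  by apply: (closed_principal LF LS eF (c_ i) (@F_ i)); apply: (lbot (LS true)).
apply/le_anti/andP; split.
  by apply/dist_product => i; rewrite /z /=; case: pselect => [E|?] /=; [rewrite E|move=> []].
have /dist_product/(_ i0) : (dist (closed_product hD F S e G) (bot (closed_product hD F S e G)) z <=
  dist (closed_product hD F S e G) (bot (closed_product hD F S e G)) z)%O by [].
apply; rewrite /z /=; case: pselect => // ? /=.
exact: (@principal_bot_proper _ _ _ F S e (cong_of (sval i0)) true).
Qed.

End Amalgam.

(** * Countable extensions *)
Lemma dependent_seq (T : Type) (P : nat -> T -> Prop) (R : nat -> T -> T -> Prop) :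
  (exists x, P 0%N x) ->
  (forall n x, P n x -> exists y, P n.+1 y /\ R n x y) ->
  exists u : nat -> T, forall n, P n (u n) /\ R n (u n) (u n.+1).
Proof.
move=> [x0 Px0] H.
have /choice[s Hs] : forall p : nat * T, exists y,
    P p.1 p.2 -> P p.1.+1 y /\ R p.1 p.2 y.
  move=> [n x]; have [/H[y Hy]|n'] := pselect (P n x); first by exists y.
  by exists x => /n'.
pose u := fix u n := if n is m.+1 then s (m, u m) else x0.
have Pu n : P n (u n) by elim: n => [|n IH] //; case: (Hs (n, u n) IH).
by exists u => n; split=> //; case: (Hs (n, u n) (Pu n)).
Qed.

Lemma finite_nat_bounded (A : set nat) : finite_set A ->
  exists N, forall n, A n -> (n < N)%N.
Proof.
move=> /finite_seqP[s ->]; elim: s => [|a s [N HN]]; first by exists 0%N.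
exists (maxn a.+1 N) => n /=; rewrite inE leq_max => /orP[/eqP->|/HN ->].
  by rewrite ltnSn.
by rewrite orbT.
Qed.

(** The injection j supplies names for new elements. *)
Section OmegaStep.
Variables (d : Order.disp_t) (D : distrLatticeType d).
Hypothesis hD : algebraic_lattice D.
Variables (V : Type) (j : nat -> V).
Hypothesis jI : injective j.

Definition restr (M : valued D V) (X : set V) : valued D V :=
  Valued X (mt M) (jn M) (dist M) (bot M).

Lemma representable_locally (M : valued D V) : representable M (car M) -> locally_representable M.
Proof. by move=> rM A fA AM; exists (car M); split. Qed.

Lemma finite_room (V' : Type) (A : set V') (B : set V) :
  finite_set A -> finite_set B ->
  exists k : V' -> V, {in A &, injective k} /\ forall v, A v -> ~ B (k v).
Proof.
move=> fA fB; have /finite_set_countable/countable_injP[f fI] := fA.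
have [|N HN] := @finite_nat_bounded (j @^-1` B).
  by apply: finite_preimage => // x y _ _; apply: jI.
exists (fun v => j (N + f v)%N); split.
  by move=> x y xA yA /jI/addnI; apply: fI.
by move=> v _ /HN; rewrite ltnNge leq_addr.
Qed.

(** One step of the chain of amalgams: G extends to an amalgam of G and Y over
    X, renamed so as to contain G. *)
Lemma finite_step (M G : valued D V) (X Y : set V) (e : V -> V) (s0 : D) :
  representable M X -> representable M Y -> X `<=` Y -> representable G (car G) -> hom M X G e ->
  compact_element s0 ->
  exists (G' : valued D V) (e' : V -> V),
  [/\ representable G' (car G'), hom M Y G' e', ext G G', forall x, X x -> e' x = e x &
    solves M Y G' e' /\ exists2 z, car G' z & dist G' (bot G') z = s0].
Proof.
move=> rX rY XY rG he cs.
pose S b := if b then G else restr M Y.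
pose ee b := if b then e else id.
have hX : hom M X (restr M X) id by split.
have hY : hom M Y (restr M Y) id by split.
have rX' : representable (restr M X) X.
  by rewrite -[X in representable _ X]image_id; apply: representable_image rX hX.
have rY' : representable (restr M Y) Y.
  by rewrite -[X in representable _ X]image_id; apply: representable_image rY hY.
have [//|||||V' [P [a [rP ha agr so [z hz kz]]]]] :=
    @amalgamation _ _ hD V (restr M X) S ee s0.
- by have [] := rX'.
- by have [] := rX'.
- by case.
- by case=> /=; [case: he => *; split|split].
- exact: cs.
have [fG LG _] := rG; have [fP LP _] := rP.
have [k [kI kG]] := finite_room fP fG.
have [N' [f [eN hf cN fE _]]] := extend_into LG (ha true) kI kG.
have hb : hom M Y P (a false) by case: (ha false) => *; split.
exists N', (f \o a false); split.
- by rewrite cN; apply: representable_image rP hf.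
- exact: hom_comp hb hf.
- exact: eN.
- move=> x Xx; rewrite /= -[x in LHS]/(ee false x) (agr false true) //.
  by rewrite fE //; apply: (hom_car he).
split.
  apply: solves_comp LP _ hb hf.
  by case: (so false) => *; split.
exists (f z); first exact: (hom_car hf).
by rewrite -(hom_bot hf) -(hom_dist hf) //; apply: lbot LP.
Qed.

Lemma representable_chain (M : valued D V) : locally_representable M -> countable (car M) ->
  exists X : nat -> set V,
  [/\ forall n, representable M (X n), forall n, X n `<=` car M,
    forall n, X n `<=` X n.+1 & forall x, car M x -> exists n, X n x].
Proof.
move=> gM /countable_injP[f fI].
have L := locally_representable_lattice gM.
have /choice[g Hg] : forall n, exists x, car M x /\
    forall y, car M y -> f y = n -> x = y.
  move=> n; have [[x [hx fx]]|no] := pselect (exists x, car M x /\ f x = n).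
    exists x; split=> // y hy fy; apply: fI; rewrite ?inE //.
    by rewrite fx.
  exists (bot M); split; first exact: lbot L.
  by move=> y hy fy; case: no; exists y.
have [||X HX] := @dependent_seq (set V) (fun n X => representable M X /\ X `<=` car M)
    (fun n X Y => X `<=` Y /\ Y (g n)).
- by have [//|X [_ XM rX]] := gM set0 (finite_set0 _); exists X.
- move=> n X [rX XM].
  have [||Y [sY YM rY]] := gM (X `|` [set g n]).
  + by rewrite finite_setU; split; [case: rX|exact: finite_set1].
  + by move=> x [/XM//|->]; case: (Hg n).
  exists Y; split=> //; split; first by move=> x Xx; apply: sY; left.
  by apply: sY; right.
exists X; split=> [n|n|n|x hx].
- by case: (HX n) => [[]].
- by case: (HX n) => [[]].
- by case: (HX n) => [_ []].
exists (f x).+1; case: (HX (f x)) => _ [_].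
by case: (Hg (f x)) => _ /(_ _ hx erefl) ->.
Qed.

(** The chain G_n of amalgams starts from the finite piece X_0 itself. The maps
    e_n from X_n to G_n agree and embed the union M of the X_n in the union of
    the G_n. Any three elements of M lie in some X_(n+1), and the elements
    wanted for them are in G_(n+1). *)
Lemma countable_step (M : valued D V) (s0 : D) :
  locally_representable M -> countable (car M) -> (forall n, ~ car M (j n)) ->
  compact_element s0 ->
  exists M' : valued D V, [/\ locally_representable M', countable (car M'), ext M M',
    car M' `<=` car M `|` range j &
    solves M (car M) M' id /\ exists2 z, car M' z & dist M' (bot M') z = s0].
Proof.
move=> gM cM jM cs; have L := locally_representable_lattice gM.
have [X [rX XM XS XU]] := representable_chain gM cM.
have Xle m n : (m <= n)%N -> X m `<=` X n.
  elim: n => [|n IH]; first by rewrite leqn0 => /eqP->.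
  by rewrite leq_eqVlt => /orP[/eqP->//|/IH H]; apply: subset_trans H _.
have [||u Hu] := @dependent_seq (valued D V * (V -> V))
  (fun n p => representable p.1 (car p.1) /\ hom M (X n) p.1 p.2)
  (fun n p q => [/\ ext p.1 q.1, forall x, X n x -> q.2 x = p.2 x,
    solves M (X n.+1) q.1 q.2 & exists2 z, car q.1 z & dist q.1 (bot q.1) z = s0]).
- have h : hom M (X 0%N) (restr M (X 0%N)) id by split.
  exists (restr M (X 0%N), id); split=> //=.
  by rewrite -[X in representable _ X]image_id; apply: representable_image (rX _) h.
- move=> n [G e] [/= rG he].
  have [G' [e' [? ? ? ? [? ?]]]] := finite_step (rX n) (rX n.+1) (@XS n) rG he cs.
  by exists (G', e').
pose G n := (u n).1; pose e n := (u n).2.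
have rG n : representable (G n) (car (G n)) by case: (Hu n) => [[]].
have he n : hom M (X n) (G n) (e n) by case: (Hu n) => [[]].
have Gle m n : (m <= n)%N -> ext (G m) (G n).
  elim: n => [|n IH]; first by rewrite leqn0 => /eqP->; apply: hom_id.
  rewrite leq_eqVlt => /orP[/eqP->|/IH H]; first exact: hom_id.
  by apply: ext_trans H _; case: (Hu n) => _ [].
have ele m n x : (m <= n)%N -> X m x -> e n x = e m x.
  move=> + Xx; elim: n => [|n IH]; first by rewrite leqn0 => /eqP->.
  rewrite leq_eqVlt => /orP[/eqP->//|mn]; rewrite -IH //.
  by case: (Hu n) => _ [_ E _ _]; apply: E; apply: Xle Xx.
pose U := dunion (G 0%N) (range G).
have dG : directed (range G).
  move=> _ _ [m _ <-] [n _ <-]; exists (G (maxn m n)); split; first by exists (maxn m n).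
    by apply: Gle; rewrite leq_maxl.
  by apply: Gle; rewrite leq_maxr.
have GU n : ext (G n) U by apply: dunion_ext.
have gU : locally_representable U.
  apply: dunion_locally_representable => //.
  by move=> _ [n _ <-]; apply: representable_locally.
have cU : countable (car U).
  rewrite /= bigcup_image; apply: bigcup_countable => // n _.
  by apply: finite_set_countable; case: (rG n).
have /choice[f Hf] : forall x, exists y, forall n, X n x -> e n x = y.
  move=> x; have [[m Xx]|no] := pselect (exists m, X m x); last first.
    by exists x => n Xx; case: no; exists n.
  exists (e m x) => n Xn.
  have [mn|/ltnW nm] := leqP m n; first exact: ele.
  by apply/esym/ele.
have LX n : lattice_on M (X n) by case: (rX n).
have hf n : hom M (X n) U f.
  apply: (hom_eq (LX n)) (hom_comp (he n) (GU n)) => x Xx /=; exact: Hf.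
have X3 x y z : car M x -> car M y -> car M z ->
    exists n, [/\ X n.+1 x, X n.+1 y & X n.+1 z].
  move=> /XU[m hm] /XU[n hn] /XU[p hp]; exists (maxn m (maxn n p)); split.
  - by apply: Xle hm; rewrite leqW // leq_maxl.
  - by apply: Xle hn; rewrite leqW // !leq_max leqnn orbT.
  - by apply: Xle hp; rewrite leqW // !leq_max leqnn !orbT.
have hM : hom M (car M) U f.
  split.
  - by move=> x hx; have [n [? _ _]] := X3 _ _ _ hx hx hx; apply: (hom_car (hf n.+1)).
  - by move=> x y hx hy; have [n [? ? _]] := X3 _ _ _ hx hy hy; apply: (hom_mt (hf n.+1)).
  - by move=> x y hx hy; have [n [? ? _]] := X3 _ _ _ hx hy hy; apply: (hom_jn (hf n.+1)).
  - by move=> x y hx hy; have [n [? ? _]] := X3 _ _ _ hx hy hy; apply: (hom_dist (hf n.+1)).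
  - exact: (hom_bot (hf 0%N)).
have sn n : solves M (X n.+1) U (e n.+1).
  have LG : lattice_on (G n.+1) (car (G n.+1)) by case: (rG n.+1).
  apply: (solves_comp LG _ (he n.+1) (GU n.+1)).
  by case: (Hu n) => _ [].
have /countable_injP[k kI] := cU.
have [||N' [g [MN hg cN gE sN]]] := @extend_into _ _ _ _ M U f (fun v => j (k v)) L hM.
- by move=> x y xU yU /jI; apply: kI.
- by move=> x _; apply: jM.
have LU := locally_representable_lattice gU.
exists N'; split=> //.
- exact: locally_representable_image gU hg cN.
- by rewrite cN; apply: sub_countable (card_image_le _ _) cU.
- by move=> x /sN[?|[v _ <-]]; [left|right; exists (k v)].
split.
  have E n x : X n x -> car M x -> g (e n x) = x by move=> Xx hx; rewrite (Hf x n Xx) gE.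
  split=> [x y z hx hy hz xy yz|x y hx hy xy].
    have [n [Xx Xy Xz]] := X3 _ _ _ hx hy hz.
    have [s1 _] := solves_comp LU (sn n) (hom_comp (he n.+1) (GU n.+1)) hg.
    by have := s1 x y z Xx Xy Xz xy yz; rewrite /= !E.
  have [n [Xx Xy _]] := X3 _ _ _ hx hy hy.
  have [_ s2] := solves_comp LU (sn n) (hom_comp (he n.+1) (GU n.+1)) hg.
  by have := s2 x y Xx Xy xy; rewrite /= !E.
have [_ [_ _ _ [z hz kz]]] := Hu 0%N.
have h := hom_comp (GU 1%N) hg.
exists (g z); first exact: (hom_car h).
by rewrite -(hom_bot h) -kz /= -(hom_dist h) //; have [_ /lbot] := rG 1%N.
Qed.

End OmegaStep.

(** * Iteration along omega_1 *)
Section WellOrder.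
Variables (W : Type) (R : rel W).
Hypothesis wo : well_order R.

Lemma wo_min (A : set W) : A !=set0 ->
  exists z, [/\ A z, forall x, A x -> R z x &
    forall y, A y -> (forall x, A x -> R y x) -> y = z].
Proof.
move=> [x Ax]; have [|z [[zA zm] zu]] := wo (A := fun w => `[< A w >]).
  by exists x; rewrite -topredE /=; apply/asboolP.
have inA y : (y \in (fun w => `[< A w >])) <-> A y.
  by rewrite -topredE /=; split => /asboolP.
exists z; split=> [|y Ay|y Ay ym]; first exact/inA.
  by apply: zm; apply/inA.
apply/esym/zu; split; first exact/inA.
by move=> u /inA; apply: ym.
Qed.

Lemma wo_refl x : R x x.
Proof. by have [|z [-> H _]] := @wo_min [set x]; [exists x|apply: H]. Qed.

Lemma wo_total x y : R x y \/ R y x.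
Proof.
have [|z [zA H _]] := @wo_min [set x; y]; first by exists x; left.
by case: zA => E; rewrite E in H; [left; apply: H; right|right; apply: H; left].
Qed.

Lemma wo_anti x y : R x y -> R y x -> x = y.
Proof.
move=> xy yx; have [|z [_ _ U]] := @wo_min [set x; y]; first by exists x; left.
have xz : x = z.
  by apply: U; [left|move=> u [->|->] //; apply: wo_refl].
have yz : y = z.
  by apply: U; [right|move=> u [->|->] //; apply: wo_refl].
by rewrite xz yz.
Qed.

Lemma wo_trans x y z : R x y -> R y z -> R x z.
Proof.
move=> xy yz; have [|m [mA H _]] := @wo_min [set x; y; z]; first by exists x; left; left.
have mx : R m x by apply: H; left; left.
have my : R m y by apply: H; left; right.
have mz : R m z by apply: H; right.
case: mA => [[E|E]|E]; rewrite {}E in mx my mz => //.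
  by rewrite (wo_anti xy mx).
by rewrite -(wo_anti yz my).
Qed.

Definition wlt y x := R y x /\ y <> x.

Lemma wlt_wf : well_founded wlt.
Proof.
move=> x; apply: contrapT => nx.
have [|m [nm H _]] := @wo_min [set x | ~ Acc wlt x]; first by exists x.
apply: nm; constructor => y [ym nym]; apply: contrapT => ny.
by apply: nym; apply: wo_anti => //; apply: H.
Qed.

Lemma wlt_cases x y : x = y \/ wlt x y \/ wlt y x.
Proof.
have [|n] := pselect (x = y); [by left|right].
by case: (wo_total x y) => h; [left|right]; split=> // E; apply: n.
Qed.

End WellOrder.

Lemma countable_setU (T : Type) (A B : set T) :
  countable A -> countable B -> countable (A `|` B).
Proof.
move=> cA cB; rewrite -bigcup2E; apply: bigcup_countable => // -[|[|i]] _ //=.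
Qed.

(** A greatest element would make the whole order countable, as one point on top
    of a countable initial segment. *)
Lemma omega1_nomax (W : Type) (R : rel W) : omega1_order R ->
  forall x, exists y, wlt R x y.
Proof.
move=> [wo nc cs] x; apply: contrapT => n; apply: nc.
have -> : [set: W] = [set x] `|` [set y | R y x /\ y <> x].
  apply/seteqP; split=> // y _; have [->|[xy|yx]] := wlt_cases wo y x; first by left.
    by right.
  by case: n; exists y.
by apply: countable_setU; [exact: countable1|exact: cs].
Qed.

Section Transfinite.
Variables (d : Order.disp_t) (D : distrLatticeType d).
Hypothesis hD : algebraic_lattice D.
Variables (W : Type) (R : rel W).
Hypothesis oW : omega1_order R.
Variable s : W -> D.
Hypothesis cs : forall a, compact_element (s a).

(* [None] is the common bottom, and stage a creates its new elements among the
   pairs (a, n). *)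
Let V := option (W * nat).
Let wo : well_order R. Proof. by case: oW. Qed.

Let M0 : valued D V := Valued [set None] (fun _ _ => None) (fun _ _ => None)
  (fun _ _ => dsup hD set0) None.

Let locally_representable0 : locally_representable M0.
Proof.
have bot0 c : (dsup hD set0 <= c)%O by apply: dsup_le.
apply: representable_locally; split; first exact: finite_set1.
  by split=> //= x y -> -> //; split.
exists set0; split=> [|i []|x y c _ _]; first by split=> // i [].
by split=> // _ i [].
Qed.

Let step_spec (a : W) (M M' : valued D V) : Prop :=
  [/\ locally_representable M', countable (car M'), ext M M',
    car M' `<=` car M `|` range (fun n => Some (a, n)) &
    solves M (car M) M' id /\ exists2 z, car M' z & dist M' (bot M') z = s a].

Let step (a : W) (M : valued D V) : valued D V := pick_or M (step_spec a M).

(* The one-element lattice M0 is included so that the least stage, too, extends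
   a nonempty union. *)
Let below (f : forall b : W, Prop) (rec : forall b, f b -> valued D V) :
  set (valued D V) := [set M0] `|` [set N | exists b (h : f b), N = rec b h].

Let stage : W -> valued D V := Fix (wlt_wf wo) (fun _ => valued D V)
  (fun a rec => step a (dunion M0 (below rec))).

Let fam a : set (valued D V) := [set M0] `|` [set N | exists2 b, wlt R b a & N = stage b].
Let U a := dunion M0 (fam a).

Let stageE a : stage a = step a (U a).
Proof.
rewrite /stage Fix_eq.
  congr (step _ (dunion _ _)); rewrite /below /fam; congr (_ `|` _).
  by apply/seteqP; split=> N [b]; [move=> [h ->]; exists b|move=> h ->; exists b, h].
move=> x f g fg; suff -> : f = g by [].
by apply/functional_extensionality_dep => b; apply/funext => h; apply: fg.
Qed.

(* The last clause keeps the names reserved for a stage unused before it. *)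
Let inv a := [/\ step_spec a (U a) (stage a), ext M0 (stage a),
  forall b, wlt R b a -> ext (stage b) (stage a) &
  forall b n, car (stage a) (Some (b, n)) -> R b a].

Let invP a : inv a.
Proof.
elim/(well_founded_ind (wlt_wf wo)): a => a IH.
have famM0 : fam a M0 by left.
have dF : directed (fam a).
  move=> M N [->|[b ba ->]] [->|[c ca ->]].
  - by exists M0; split=> //; apply: hom_id.
  - exists (stage c); split; [by right; exists c| |exact: hom_id].
    by case: (IH c ca).
  - exists (stage b); split; [by right; exists b|exact: hom_id|].
    by case: (IH b ba).
  have [->|[bc|cb]] := wlt_cases wo b c.
  - by exists (stage c); split; [right; exists c|exact: hom_id|exact: hom_id].
  - exists (stage c); split; [by right; exists c| |exact: hom_id].
    by case: (IH c ca) => _ _ H _; apply: H.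
  - exists (stage b); split; [by right; exists b|exact: hom_id|].
    by case: (IH b ba) => _ _ H _; apply: H.
have gU : locally_representable (U a).
  apply: dunion_locally_representable => // _ [->//|[b ba ->]].
  by case: (IH b ba) => [[]].
have cU : countable (car (U a)).
  have UE : car (U a) `<=` [set None] `|`
      \bigcup_(b in [set b | R b a /\ b <> a]) car (stage b).
    by move=> x [N [->|[b ba ->]] hx]; [left|right; exists b].
  apply: sub_countable (subset_card_le UE) _.
  apply: countable_setU; first exact: countable1.
  apply: bigcup_countable; first by case: oW.
  by move=> b ba; case: (IH b ba) => [[]].
have aU n : ~ car (U a) (Some (a, n)).
  move=> [N [->//|[b ba ->]]]; have [_ _ _ H] := IH b ba => /H ab.
  by case: ba => ba; apply; apply: (wo_anti wo).
have jI : injective (fun n : nat => Some (a, n) : V) by move=> m n [].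
have sp : step_spec a (U a) (stage a).
  rewrite stageE /step; have [M' HM'] := @countable_step _ _ hD V _ jI (U a) (s a) gU cU aU (@cs a).
  by rewrite /pick_or; case: xgetP => [M -> //|/(_ M')].
have [_ _ UM sub _] := sp.
split=> //.
- by apply: ext_trans (dunion_ext dF famM0 famM0) UM.
- by move=> b ba; apply: ext_trans UM; apply: dunion_ext => //; right; exists b.
move=> b n /sub[[N [->//|[c ca ->]]] hN|[m _ [<- _]]]; last exact: wo_refl.
have [_ _ _ H] := IH c ca.
by apply: (wo_trans wo) (H _ _ hN) _; case: ca.
Qed.

(** The union of all stages. Elements of the union lie in a common stage, and a
    later stage contains what is wanted for them; it exists because omega_1 has
    no greatest element. *)
Lemma solved_lattice_exists : exists M : valued D V,
  [/\ locally_representable M, solves M (car M) M id &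
   forall a, exists2 z, car M z & dist M (bot M) z = s a].
Proof.
have [a0 _] : exists a : W, True.
  apply: contrapT => n; case: oW => _ + _; apply.
  rewrite (_ : [set: W] = set0) //.
  by apply/seteqP; split=> // a _; apply: n; exists a.
pose F := range stage.
have dF : directed F.
  move=> _ _ [b _ <-] [c _ <-].
  have [->|[bc|cb]] := wlt_cases wo b c.
  - by exists (stage c); split; [exists c|exact: hom_id|exact: hom_id].
  - exists (stage c); split; [by exists c| |exact: hom_id].
    by case: (invP c) => _ _ H _; apply: H.
  - exists (stage b); split; [by exists b|exact: hom_id|].
    by case: (invP b) => _ _ H _; apply: H.
have F0 : F (stage a0) by exists a0.
pose M := dunion (stage a0) F.
have SM a : ext (stage a) M by apply: dunion_ext => //; exists a.
have gM : locally_representable M.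
  by apply: dunion_locally_representable => // _ [a _ <-]; case: (invP a) => [[]].
have up x y z : car M x -> car M y -> car M z ->
    exists a, [/\ car (U a) x, car (U a) y & car (U a) z].
  move=> [_ [a _ <-] xa] [_ [b _ <-] yb] [_ [c _ <-] zc].
  have [_ [e _ <-] [ae be]] : exists2 N, F N & ext (stage a) N /\ ext (stage b) N.
    have [N [FN ? ?]] := dF _ _ (ex_intro2 _ _ a I erefl) (ex_intro2 _ _ b I erefl).
    by exists N.
  have [_ [f _ <-] [ef cf]] : exists2 N, F N & ext (stage e) N /\ ext (stage c) N.
    have [N [FN ? ?]] := dF _ _ (ex_intro2 _ _ e I erefl) (ex_intro2 _ _ c I erefl).
    by exists N.
  have [g fg] := omega1_nomax oW f; exists g.
  have FU : forall v, car (stage f) v -> car (U g) v.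
    by move=> v hv; exists (stage f) => //; right; exists f.
  split; apply: FU.
  - exact: (hom_car ef (hom_car ae xa)).
  - exact: (hom_car ef (hom_car be yb)).
  - exact: (hom_car cf zc).
exists M; split=> //.
  split=> [x y z hx hy hz xy yz|x y hx hy xy].
    have [a [xa ya za]] := up _ _ _ hx hy hz.
    have [[_ _ UM _ [[s1 _] _]] _ _ _] := invP a.
    have h := ext_trans UM (SM a).
    have [w hw [wx wz]] := s1 x y z xa ya za (etrans (hom_mt h xa ya) xy)
      (etrans (hom_mt h ya za) yz).
    exists w; first exact: (hom_car (SM a)).
    have ya' := hom_car UM ya.
    split; first by rewrite -[RHS]wx; apply/esym/(hom_mt (SM a)).
    by rewrite -[RHS]wz; apply/esym/(hom_jn (SM a)).
  have [a [xa ya _]] := up _ _ _ hx hy hy.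
  have [[gS _ UM _ [[_ s2] _]] _ _ _] := invP a.
  have h := ext_trans UM (SM a).
  have gUL : car (U a) (bot (U a)) by exists M0 => //; left.
  have [|q [q' [hq hq' qq E]]] := s2 x y xa ya.
    by rewrite (hom_dist h) // (hom_dist h gUL ya) (hom_bot h).
  have L := locally_representable_lattice gS.
  have xa' := hom_car UM xa; have ya' := hom_car UM ya.
  have j := ljn L hq ya'; have j' := ljn L hq' ya'; have m := lmt L j j'.
  exists q, q'; split; try exact: (hom_car (SM a)).
    by rewrite -(hom_bot (SM a)) -[RHS]qq; apply/esym/(hom_mt (SM a)).
  rewrite -[RHS]E -[RHS]/(id _) (hom_mt (SM a)) //.
  by rewrite (hom_mt (SM a) j j') (hom_jn (SM a) hq ya') (hom_jn (SM a) hq' ya').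
move=> a; have [[gS _ _ _ [_ [z hz kz]]] _ _ _] := invP a.
have L := locally_representable_lattice gS.
exists z; first exact: (hom_car (SM a)).
by rewrite -(hom_bot (SM a)) -kz -(hom_dist (SM a)) //; apply: lbot.
Qed.

End Transfinite.

(** * The congruence lattice of the union *)
Section LatticeOf.
Variables (d : Order.disp_t) (D : distrLatticeType d) (V : Type) (M : valued D V).

Lemma mt_jn x y : lattice_on M (car M) -> car M x -> car M y ->
  mt M x y = x <-> jn M x y = y.
Proof.
move=> L hx hy; split=> E.
  by rewrite -{1}E (jnC L) ?(mtC L hx) ?(jnmt L) //; apply: lmt.
by rewrite -{1}E (mtjn L).
Qed.

Definition lat_of (gM : locally_representable M) : Type := {x : V | car M x}.

Variable gM : locally_representable M.
Local Notation L := (lat_of gM).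

HB.instance Definition _ := gen_eqMixin L.
HB.instance Definition _ := gen_choiceMixin L.

Let law := locally_representable_lattice gM.

Definition lat_le (x y : L) : bool := `[< mt M (sval x) (sval y) = sval x >].
Definition lat_meet (x y : L) : L := exist _ _ (lmt law (svalP x) (svalP y)).
Definition lat_join (x y : L) : L := exist _ _ (ljn law (svalP x) (svalP y)).
Definition lat_bot : L := exist _ _ (lbot law).

Lemma sval_inj (x y : L) : sval x = sval y -> x = y.
Proof. by move=> /eq_sig_hprop; apply=> *; apply: Prop_irrelevance. Qed.

Lemma lat_le_refl : reflexive lat_le.
Proof. by move=> x; apply/asboolP; exact: (mtxx law (svalP x)). Qed.

Lemma lat_le_anti : antisymmetric lat_le.
Proof.
move=> x y /andP[/asboolP xy /asboolP yx]; apply: sval_inj.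
by rewrite -xy (mtC law) //; apply: svalP.
Qed.

Lemma lat_le_trans : transitive lat_le.
Proof.
move=> y x z /asboolP xy /asboolP yz; apply/asboolP.
by rewrite -xy -(mtA law) ?yz //; apply: svalP.
Qed.

Lemma lat_meetP x y z : lat_le x (lat_meet y z) = lat_le x y && lat_le x z.
Proof.
have [[hx hy] hz] := (svalP x, svalP y, svalP z).
apply/asboolP/andP => /= [E|[/asboolP xy /asboolP xz]]; last by rewrite (mtA law) ?xy.
have hm := lmt law hy hz.
have my : mt M (mt M (sval y) (sval z)) (sval y) = mt M (sval y) (sval z).
  by rewrite (mtC law hy hz) -(mtA law) // (mtxx law).
have mz : mt M (mt M (sval y) (sval z)) (sval z) = mt M (sval y) (sval z).
  by rewrite -(mtA law) // (mtxx law).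
by split; apply/asboolP; rewrite -{1}E -(mtA law) // (my, mz).
Qed.

Lemma lat_joinP x y z : lat_le (lat_join x y) z = lat_le x z && lat_le y z.
Proof.
have [[hx hy] hz] := (svalP x, svalP y, svalP z).
have hj := ljn law hx hy.
apply/asboolP/andP => /= [/(mt_jn law hj hz) E|[/asboolP xz /asboolP yz]].
  split; apply/asboolP/(mt_jn law) => //; rewrite -{1}E (jnA law) //.
    by rewrite (jnA law) // (jnxx law) // E.
  by rewrite (jnC law hx hy) (jnA law) // (jnxx law) // (jnC law hy hx) E.
move: xz yz => /(mt_jn law hx hz) xz /(mt_jn law hy hz) yz.
by apply/(mt_jn law) => //; rewrite -(jnA law) // yz.
Qed.

Lemma lat_le0 x : lat_le lat_bot x.
Proof. by apply/asboolP; apply: (mt0 law); apply: svalP. Qed.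

HB.instance Definition _ := Order.Le_isPOrder.Build con_display L
  lat_le_refl lat_le_anti lat_le_trans.
HB.instance Definition _ := Order.POrder_MeetJoin_isLattice.Build con_display L
  lat_meetP lat_joinP.
HB.instance Definition _ := Order.hasBottom.Build con_display L lat_le0.

Lemma lat_locally_finite : locally_finite L.
Proof.
move=> X fX.
have [|Y [XY YM [fY LY _]]] := gM (finite_image sval fX).
  by move=> _ [x _ <-]; apply: svalP.
apply: (@sub_finite_set _ _ (sval @^-1` Y)); last first.
  by apply: finite_preimage => // x y _ _; apply: sval_inj.
apply: smallest_sub; last by move=> x Xx; apply: XY; exists x.
by move=> x y hx hy; split; [exact: lmt LY _ _ _ _|exact: ljn LY _ _ _ _].
Qed.

End LatticeOf.

Lemma order_iso_lattice (d d' : Order.disp_t) (L : latticeType d)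
    (K : latticeType d') (f : L -> K) (g : K -> L) :
  cancel f g -> cancel g f ->
  (forall x y, (x <= y)%O -> (f x <= f y)%O) ->
  (forall x y, (x <= y)%O -> (g x <= g y)%O) -> lattice_isomorphic L K.
Proof.
move=> fK gK fm gm; exists f; split; first by exists g.
  move=> x y; apply/le_anti/andP; split.
    by rewrite lexI !fm ?leIl ?leIr.
  rewrite -[leLHS]gK; apply: fm; rewrite lexI.
  by rewrite -{2}[x]fK -{3}[y]fK !gm ?leIl ?leIr.
move=> x y; apply/le_anti/andP; split; last by rewrite leUx !fm ?leUl ?leUr.
rewrite -[leRHS]gK; apply: fm; rewrite leUx.
by rewrite -{1}[x]fK -{2}[y]fK !gm ?leUl ?leUr.
Qed.

Lemma cong_meet_join (d : Order.disp_t) (L : latticeType d) (t : congruence L)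
  (x y : L) : t (Order.meet x y) (Order.join x y) <-> t x y.
Proof.
have [r s tr] := con_equivalence t; split=> H.
  apply: (tr _ (Order.meet x y)).
    apply: s; have := con_meet (r x) H.
    by rewrite meetA meetxx joinKI.
  have := con_meet (r y) H.
  by rewrite (meetC x) meetA meetxx joinC joinKI meetC.
apply: (tr _ x).
  by have := con_meet (r x) (s _ _ H); rewrite meetxx.
by have := con_join (r x) H; rewrite joinxx.
Qed.

Section Representation.
Variables (d : Order.disp_t) (D : distrLatticeType d).
Hypothesis hD : algebraic_lattice D.
Variables (V : Type) (M : valued D V).
Hypothesis gM : locally_representable M.
Hypothesis sM : solves M (car M) M id.
Hypothesis vM : forall c : D, compact_element c ->
  exists2 z, car M z & dist M (bot M) z = c.

Local Notation L := (lat_of gM).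
Local Open Scope order_scope.
Let k (x y : L) : D := dist M (sval x) (sval y).
Let mu (x : L) := k \bot x.

Lemma lat_relatively_complemented : relatively_complemented L.
Proof.
move=> a b c /asboolP ab /asboolP bc.
have [w hw [wa wc]] := solves_compl sM (svalP a) (svalP b) (svalP c) ab bc.
by exists (exist _ w hw); split; apply: sval_inj.
Qed.

Lemma sectional_complement (x y : L) : x <= y ->
  exists w, x `&` w = \bot /\ x `|` w = y.
Proof. by move=> xy; apply: lat_relatively_complemented. Qed.

Let kC c : cong_on M (car M) (fun x y => dist M x y <= c).
Proof. exact: dist_cong. Qed.

Lemma level_equivalence c : RelationClasses.Equivalence (fun x y : L => k x y <= c).
Proof.
split.
- by move=> x; apply: (cong_refl (kC c)); apply: svalP.
- by move=> x y; apply: (cong_sym (kC c)); apply: svalP.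
- by move=> x y z; apply: (cong_trans (kC c)); apply: svalP.
Qed.

Lemma level_meet c (x x' y y' : L) : k x x' <= c -> k y y' <= c ->
  k (x `&` y) (x' `&` y') <= c.
Proof.
move=> xx yy; have [_ _ tr] := level_equivalence c.
apply: (tr _ (x' `&` y)).
  by apply: (cong_mt (kC c)) => //; apply: svalP.
by rewrite !(meetC x'); apply: (cong_mt (kC c)) => //; apply: svalP.
Qed.

Lemma level_join c (x x' y y' : L) : k x x' <= c -> k y y' <= c ->
  k (x `|` y) (x' `|` y') <= c.
Proof.
move=> xx yy; have [_ _ tr] := level_equivalence c.
apply: (tr _ (x' `|` y)).
  by apply: (cong_jn (kC c)) => //; apply: svalP.
by rewrite !(joinC x'); apply: (cong_jn (kC c)) => //; apply: svalP.
Qed.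

Definition level (c : D) : congruence L :=
  Congruence (level_equivalence c) (@level_meet c) (@level_join c).

Lemma mu_le (x y : L) : x <= y -> mu x <= mu y.
Proof.
move=> xy; have [r _ _] := level_equivalence (mu y).
have := @level_meet (mu y) x x \bot y (r x) (lexx _).
by rewrite meetx0 (meet_idPl xy).
Qed.

(** If y is congruent to the bottom, then q and q' are congruent to their joins
    with y. Hence the meet of these joins, which is above x, is congruent to
    the meet of q and q', the bottom. *)
Lemma cong_zero_class_mu (t : congruence L) (x y : L) : mu x <= mu y -> t \bot y -> t \bot x.
Proof.
move=> xy ty; have [r s tr] := con_equivalence t.
have [q [q' [hq hq' qq E]]] := solves_gen sM (svalP x) (svalP y) xy.
pose p : L := exist _ q hq; pose p' : L := exist _ q' hq'.
have pp : p `&` p' = \bot by apply: sval_inj.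
have xE : x `&` ((p `|` y) `&` (p' `|` y)) = x by apply: sval_inj.
have tp : t p (p `|` y) by rewrite -{1}[p]joinx0; apply: con_join.
have tp' : t p' (p' `|` y) by rewrite -{1}[p']joinx0; apply: con_join.
have := con_meet tp tp'; rewrite pp => H.
by have := con_meet (r x) H; rewrite xE meetx0.
Qed.

(** The inverse of [level]. *)
Definition cong_value (t : congruence L) : D := dsup hD (mu @` [set x | t \bot x]).

(** By compactness mu x is below the join of finitely many mu z with z in the
    zero class of t. The join of these z is again in the zero class, and mu is
    monotone, so a single z suffices. *)
Lemma mu_cong_value (t : congruence L) x : mu x <= cong_value t -> t \bot x.
Proof.
have [r s tr] := con_equivalence t.
move=> xt.
have cx : compact_element (mu x) by apply: (dist_compact hD gM); apply: svalP.
have [F [fF Ft xF]] := compact_dsup cx xt.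
suff [z tz Fz] : exists2 z, t \bot z & forall a, F a -> a <= mu z.
  by apply: cong_zero_class_mu tz; apply: le_trans xF _; apply: dsup_le.
move: fF Ft => /finite_seqP[l ->]; elim: l => [_|a l IH Ft]; first by exists \bot.
have [|z tz lz] := IH; first by move=> b bl; apply: Ft; rewrite /= inE bl orbT.
have [|y ty ya] := Ft a; first by rewrite /= mem_head.
exists (z `|` y); first by rewrite -[X in t X _]joinxx; apply: con_join.
move=> b /=; rewrite inE => /orP[/eqP->|bl].
  by rewrite -ya; apply: mu_le; apply: leUr.
by apply: le_trans (lz _ bl) _; apply: mu_le; apply: leUl.
Qed.

(** A pair in t may be replaced by its meet u and its join v. The complement w
    of u in the interval from the bottom to v is in the zero class of t, and v
    is the join of u and w. *)
Lemma con_le_zero_class (t u : congruence L) :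
  (forall x, t \bot x -> u \bot x) -> con_le t u.
Proof.
move=> H; apply/con_leP => x y /cong_meet_join txy; apply/cong_meet_join.
have [_ s _] := con_equivalence t; have [ru _ _] := con_equivalence u.
have [rt _ _] := con_equivalence t.
have [|w [xw E]] := @sectional_complement (x `&` y) (x `|` y).
  exact: le_trans (leIl _ _) (leUl _ _).
rewrite -E -[X in u X _]joinx0; apply: con_join => //; apply: H.
have := con_meet txy (rt w); rewrite xw -E.
by rewrite [(_ `|` w) `&` w]meetC joinC joinKI.
Qed.

Lemma con_lattice_isomorphic : lattice_isomorphic (congruence L) D.
Proof.
have fm (t u : congruence L) : t <= u -> cong_value t <= cong_value u.
  move=> /con_leP tu; apply: dsupS => _ [x tx <-]; exists x => //; exact: tu.
have gm b c : b <= c -> level b <= level c.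
  by move=> bc; apply/con_leP => x y /= h; apply: le_trans h bc.
apply: (@order_iso_lattice _ _ _ _ cong_value level) => //.
  move=> t; apply/le_anti/andP; split; apply: con_le_zero_class => x /=.
    exact: mu_cong_value.
  by move=> tx; apply: dsup_ub; exists x.
move=> c; apply/le_anti/andP; split; first by apply: dsup_le => _ [x tx <-].
have [A [cA sA]] := hD.2 c.
apply: sA.2 => a Aa; have [z hz za] := vM (cA _ Aa).
apply: dsup_ub; exists (exist _ z hz) => //.
by change (dist M (bot M) z <= c); rewrite za; apply: sA.1.
Qed.

End Representation.

Theorem theorem2 (d : Order.disp_t) (D : distrLatticeType d)
    (hD : algebraic_lattice D)
    (hK : card_le_aleph1 [set c : D | compact_element c]) :
  exists (d' : Order.disp_t) (L : bLatticeType d'),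
    [/\ locally_finite L, relatively_complemented L &
        lattice_isomorphic (congruence L) D].
Proof.
have [W [R [oW /card_leP[f]]]] := hK.
(* The injection of the compact elements into W is turned into an enumeration
   by W; indices outside the image are given the least element. *)
have /choice[s Hs] : forall w : W, exists c : D, compact_element c /\
    forall c' (h : compact_element c'),
      val (f (SigSub (mem_set (h : [set c : D | compact_element c] c')))) = w ->
      c' = c.
  move=> w; have [[c [h fc]]|no] := pselect (exists c (h : compact_element c),
      val (f (SigSub (mem_set (h : [set c : D | compact_element c] c)))) = w).
    exists c; split=> // c' h' fc'.
    have /val_inj E : val (f (SigSub (mem_set
        (h' : [set c : D | compact_element c] c')))) =
      val (f (SigSub (mem_set (h : [set c : D | compact_element c] c)))).
      by rewrite fc fc'.
    exact: (congr1 val (injT E)).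
  exists (dsup hD set0); split; first exact: compact_finite.
  by move=> c h fc; case: no; exists c, h.
have [M [gM sM vM]] := solved_lattice_exists hD oW (fun w => (Hs w).1).
exists con_display, (lat_of gM); split.
- exact: lat_locally_finite.
- exact: lat_relatively_complemented.
apply: (con_lattice_isomorphic hD) => // c hc.
have [z hz zc] := vM (val (f (SigSub (mem_set
  (hc : [set c : D | compact_element c] c))))).
by exists z => //; rewrite zc; apply/esym/(Hs _).2.
Qed.
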